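(* Let $K$ be a field and let $\phi:\mathfrak g\hookrightarrow\mathfrak h$ be a monomorphism of Lie algebras over $K$. Then $\operatorname{cd}(\phi)=\operatorname{cd}(\mathfrak g)$.
   Context: Lie algebras are over a field $K$ and may be infinite-dimensional. Modules over a Lie algebra $\mathfrak g$ are left $\mathfrak g$-modules, equivalently left modules over the universal enveloping algebra $U(\mathfrak g)$ (no finiteness assumption). $H^n(\mathfrak g,M)$ denotes Chevalley--Eilenberg cohomology (equivalently $\operatorname{Ext}^n_{U(\mathfrak g)}(K,M)$). The cohomological dimension $\operatorname{cd}(\mathfrak g)$ is the maximal integer $n$ such that $H^n(\mathfrak g,M)\ne 0$ for some $\mathfrak g$-module $M$ ($\infty$ if no maximum exists). For a Lie algebra homomorphism $\phi:\mathfrak g\to\mathfrak h$ and an $\mathfrak h$-module $M$, regarded as a $\mathfrak g$-module by restriction along $\phi$, there is an induced map $\phi^*:H^n(\mathfrak h,M)\to H^n(\mathfrak g,M)$ for each $n\ge 0$. The cohomological dimension of $\phi$ is $$\operatorname{cd}(\phi)=\sup\{n\ge 0:\ \text{there is an }\mathfrak h\text{-module }M\text{ with }\phi^*:H^n(\mathfrak h,M)\to H^n(\mathfrak g,M)\text{ nonzero}\},$$ a value in $\{0,1,2,\dots\}\cup\{\infty\}$. *)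

(* Defs.v *)
From HB Require Import structures.
From mathcomp Require Import all_boot all_algebra.
From mathcomp Require Import boolp classical_sets functions.

Set Implicit Arguments.
Unset Strict Implicit.
Unset Printing Implicit Defensive.

Import GRing.Theory.
Local Open Scope ring_scope.
Local Open Scope quotient_scope.

(* No bound on the dimension. In characteristic 2 alternation is stronger     *)
(* than antisymmetry, hence [bracketxx].                                      *)
HB.mixin Record Lmodule_isLieAlgebra (K : fieldType) L
    of GRing.Lmodule K L := {
  bracket : L -> L -> L;
  bracketPl : forall (a : K) (x y z : L),
    bracket (a *: x + y) z = a *: bracket x z + bracket y z;
  bracketPr : forall (a : K) (x y z : L),
    bracket x (a *: y + z) = a *: bracket x y + bracket x z;
  bracketxx : forall x : L, bracket x x = 0;
  jacobi : forall x y z : L,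
    bracket x (bracket y z) + bracket y (bracket z x)
      + bracket z (bracket x y) = 0
}.

#[short(type="lieAlgType")]
HB.structure Definition LieAlgebra (K : fieldType) :=
  {L of Lmodule_isLieAlgebra K L & GRing.Lmodule K L}.

HB.mixin Record Lmodule_isLieModule (K : fieldType) (g : lieAlgType K) M
    of GRing.Lmodule K M := {
  act : g -> M -> M;
  actPl : forall (a : K) (x y : g) (m : M),
    act (a *: x + y) m = a *: act x m + act y m;
  actPr : forall (a : K) (x : g) (m p : M),
    act x (a *: m + p) = a *: act x m + act x p;
  act_bracket : forall (x y : g) (m : M),
    act (bracket x y) m = act x (act y m) - act y (act x m)
}.

#[short(type="lieModType")]
HB.structure Definition LieModule (K : fieldType) (g : lieAlgType K) :=
  {M of Lmodule_isLieModule K g M & GRing.Lmodule K M}.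

HB.mixin Record isLieMorphism (K : fieldType) (g h : lieAlgType K)
    (f : g -> h) := {
  lie_morphB : forall x y : g, f (bracket x y) = bracket (f x) (f y)
}.

#[short(type="lieHom")]
HB.structure Definition LieMorphism (K : fieldType) (g h : lieAlgType K) :=
  {f of isLieMorphism K g h f & @GRing.Linear K g h *:%R f}.

Section Restriction.
Variables (K : fieldType) (g h : lieAlgType K) (phi : lieHom g h).
Variable M : lieModType h.

Definition restr (_ : lieHom g h) (N : lieModType h) : Type := N.
Local Notation rM := (restr phi M).

HB.instance Definition _ := GRing.Lmodule.copy rM M.

Definition restr_act (x : g) (m : rM) : rM := act (phi x) (m : M).

Fact restr_actPl (a : K) (x y : g) (m : rM) :
  restr_act (a *: x + y) m = a *: restr_act x m + restr_act y m.
Proof. by rewrite /restr_act linearP actPl. Qed.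

Fact restr_actPr (a : K) (x : g) (m p : rM) :
  restr_act x (a *: m + p) = a *: restr_act x m + restr_act x p.
Proof. exact: actPr. Qed.

Fact restr_act_bracket (x y : g) (m : rM) :
  restr_act (bracket x y) m =
    restr_act x (restr_act y m) - restr_act y (restr_act x m).
Proof. by rewrite /restr_act lie_morphB act_bracket. Qed.

HB.instance Definition _ := @Lmodule_isLieModule.Build K g rM
  restr_act restr_actPl restr_actPr restr_act_bracket.

End Restriction.

(* The n-tuple (a, y_0, ..., y_(n-2)); for n = 0 the value is irrelevant.     *)
Definition fcons (T : Type) (n : nat) (a : T) :
    ('I_n.-1 -> T) -> 'I_n -> T :=
  match n with
  | 0 => fun _ _ => a
  | _.+1 => fun y k => oapp y a (unlift ord0 k)
  end.

Lemma comp_fcons (T U : Type) (p : T -> U) n a (y : 'I_n.-1 -> T) :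
  p \o fcons a y = fcons (p a) (p \o y).
Proof. by case: n y => // n y; apply: funext => k /=; case: unlift. Qed.

Section ChevalleyEilenberg.
Variables (K : fieldType) (g : lieAlgType K) (M : lieModType g).

Definition multilinear n (f : ('I_n -> g) -> M) : Prop :=
  forall (i : 'I_n) (x : 'I_n -> g) (a : K) (u v : g),
    f [eta x with i |-> a *: u + v] =
      a *: f [eta x with i |-> u] + f [eta x with i |-> v].

Definition alternating n (f : ('I_n -> g) -> M) : Prop :=
  forall (x : 'I_n -> g) (i j : 'I_n), i != j -> x i = x j -> f x = 0.

(* (df)(x_0, ..., x_n) =                                                      *)
(*     \sum_i (-1)^i x_i . f(..., ^x_i, ...)                                  *)
(*   + \sum_(i < j) (-1)^(i + j) f([x_i, x_j], ..., ^x_i, ..., ^x_j, ...)     *)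
(* For i < j we have i : 'I_n and lift j i = i as naturals, and               *)
(* lift j \o lift i enumerates increasingly the indices other than i and j.   *)
Definition ce_diff n (f : ('I_n -> g) -> M) : ('I_n.+1 -> g) -> M :=
  fun x =>
    \sum_(i < n.+1) (-1) ^+ i *: act (x i) (f (x \o lift i))
    + \sum_(j < n.+1) \sum_(i < n | (i < j)%N)
        (-1) ^+ (i + j) *:
          f (fcons (bracket (x (lift j i)) (x j)) (x \o lift j \o lift i)).

Definition cochain n : {pred ('I_n -> g) -> M} :=
  [pred f | `[< multilinear f /\ alternating f >]].

Definition cocycle n : {pred ('I_n -> g) -> M} :=
  [pred f | (f \in @cochain n) && (ce_diff f == 0)].

Definition is_coboundary n : (('I_n -> g) -> M) -> Prop :=
  match n with
  | 0 => fun f => f = 0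
  | m.+1 => fun f => exists2 c, c \in @cochain m & f = ce_diff c
  end.

Lemma cochainP n (f : ('I_n -> g) -> M) :
  reflect (multilinear f /\ alternating f) (f \in @cochain n).
Proof. exact: asboolP. Qed.

Lemma cocycleP n (f : ('I_n -> g) -> M) :
  reflect (f \in @cochain n /\ ce_diff f = 0) (f \in @cocycle n).
Proof. by apply: (iffP andP) => -[? /eqP]. Qed.

Lemma ce_diffP n (a : K) (f f' : ('I_n -> g) -> M) :
  ce_diff (a *: f + f') = a *: ce_diff f + ce_diff f'.
Proof.
apply: funext => x; rewrite /ce_diff.
rewrite -[RHS]/(a *: ce_diff f x + ce_diff f' x) /ce_diff.
rewrite scalerDr addrACA !scaler_sumr -!big_split /=.
apply: eq_bigr => j _; congr (_ + _).
  rewrite -[(_ + _) _]/(a *: f _ + f' _) actPr.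
  by rewrite scalerDr !scalerA mulrC.
rewrite scaler_sumr -big_split /=.
apply: eq_bigr => i _; rewrite -[(_ + _) _]/(a *: f _ + f' _).
by rewrite scalerDr !scalerA mulrC.
Qed.

Lemma ce_diff0 n : ce_diff (0 : ('I_n -> g) -> M) = 0.
Proof.
have := ce_diffP (-1) (0 : ('I_n -> g) -> M) 0.
by rewrite !scaleN1r !addNr.
Qed.

Fact cochain_submod n : submod_closed (@cochain n).
Proof.
split; first by apply/cochainP; split=> // i x a u v; rewrite scaler0 addr0.
move=> a f f' /cochainP[mf af] /cochainP[mf' af']; apply/cochainP; split.
  move=> i x b u v; rewrite -!/(a *: f _ + f' _).
  rewrite -[LHS]/(a *: f _ + f' _) mf mf' -![(_ + _) _]/(a *: f _ + f' _).
  by rewrite !scalerDr !scalerA (mulrC a b) addrACA.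
move=> x i j nij xij; rewrite -[LHS]/(a *: f _ + f' _).
by rewrite (af x i j) // (af' x i j) // scaler0 addr0.
Qed.

Fact cocycle_submod n : submod_closed (@cocycle n).
Proof.
have [C0 CP] := cochain_submod n; split.
  by apply/cocycleP; rewrite ce_diff0.
move=> a f f' /cocycleP[Cf df] /cocycleP[Cf' df']; apply/cocycleP.
by split; [exact: CP | rewrite ce_diffP df df' scaler0 addr0].
Qed.

HB.instance Definition _ n :=
  GRing.isSubmodClosed.Build K (('I_n -> g) -> M) (@cocycle n)
    (cocycle_submod n).

Definition Zspace n : Type := {f : ('I_n -> g) -> M | f \in @cocycle n}.
HB.instance Definition _ n := SubChoice.on (Zspace n).
HB.instance Definition _ n := [SubChoice_isSubLmodule of Zspace n by <:].

(* Coboundaries are taken inside the cocycles, so that no appeal to the       *)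
(* identity d^2 = 0 is needed to form the quotient.                           *)
Definition coboundary n : {pred Zspace n} :=
  [pred z | `[< is_coboundary (\val z) >]].

Lemma coboundaryP n (z : Zspace n) :
  reflect (is_coboundary (\val z)) (z \in @coboundary n).
Proof. exact: asboolP. Qed.

Fact coboundary_submod n : submod_closed (@coboundary n).
Proof.
have [C0 _] := cochain_submod n.-1; split.
  apply/coboundaryP; rewrite raddf0; case: n C0 => [|n] C0 //=.
  by exists 0; rewrite ?ce_diff0.
move=> a z z' /coboundaryP Bz /coboundaryP Bz'; apply/coboundaryP.
rewrite linearP; case: n C0 z z' Bz Bz' => [|n] C0 z z' /=.
  by move=> -> ->; rewrite scaler0 addr0.
move=> [c Cc ->] [c' Cc' ->]; exists (a *: c + c'); last by rewrite ce_diffP.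
by have [_ CP] := cochain_submod n; apply: CP.
Qed.

HB.instance Definition _ n :=
  GRing.isSubmodClosed.Build K (Zspace n) (@coboundary n)
    (coboundary_submod n).

Definition cohomology n : zmodType := Quotient.quot (@coboundary n).

End ChevalleyEilenberg.

Section InducedMap.
Variables (K : fieldType) (g h : lieAlgType K) (phi : lieHom g h).
Variable M : lieModType h.
Local Notation rM := (restr phi M).

Definition pullback n (f : ('I_n -> h) -> M) : ('I_n -> g) -> rM :=
  fun x => f (phi \o x).

Lemma pullback_cochain n (f : ('I_n -> h) -> M) :
  f \in @cochain _ _ M n -> pullback f \in @cochain _ _ rM n.
Proof.
move=> /cochainP[mf af]; apply/cochainP; split.
  have phiE x (i : 'I_n) u :
      phi \o [eta x with i |-> u] = [eta phi \o x with i |-> phi u].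
    by apply: funext => k /=; case: eqP.
  by move=> i x a u v; rewrite /pullback !phiE linearP mf.
move=> x i j nij xij; apply: (af _ i j) => //=.
by rewrite xij.
Qed.

Lemma ce_diff_pullback n (f : ('I_n -> h) -> M) :
  ce_diff (pullback f) = pullback (ce_diff f).
Proof.
apply: funext => x; rewrite /ce_diff /pullback; congr (_ + _).
apply: eq_bigr => j _; apply: eq_bigr => i _.
by rewrite comp_fcons lie_morphB.
Qed.

Fact pullback_cocycle n (z : Zspace M n) :
  pullback (\val z) \in @cocycle _ _ rM n.
Proof.
have /cocycleP[Cz dz] := valP z; apply/cocycleP.
by rewrite pullback_cochain // ce_diff_pullback dz.
Qed.

Definition pullbackZ n (z : Zspace M n) : Zspace rM n :=
  Sub (pullback (\val z)) (pullback_cocycle z).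

(* phi^* is defined on representatives; [induced_map_pi] is its               *)
(* well-definedness.                                                          *)
Definition induced_map n (c : cohomology M n) : cohomology rM n :=
  \pi_(cohomology rM n) (pullbackZ (repr c)).

Lemma pullbackZB n (z z' : Zspace M n) :
  pullbackZ (z - z') = pullbackZ z - pullbackZ z'.
Proof. by apply: val_inj. Qed.

Lemma pullbackZ_coboundary n (z : Zspace M n) :
  z \in @coboundary _ _ M n -> pullbackZ z \in @coboundary _ _ rM n.
Proof.
move=> /coboundaryP Bz; apply/coboundaryP; rewrite SubK.
case: n z Bz => [|n] z /=; first by move=> ->.
move=> [c Cc ->]; exists (pullback c); first exact: pullback_cochain.
by rewrite ce_diff_pullback.
Qed.

Lemma induced_map_pi n (z : Zspace M n) :
  induced_map (\pi_(cohomology M n) z) = \pi_(cohomology rM n) (pullbackZ z).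
Proof.
apply/eqP; rewrite -Quotient.idealrBE -pullbackZB; apply: pullbackZ_coboundary.
by rewrite Quotient.idealrBE reprK.
Qed.

End InducedMap.

(* Values in {0, 1, 2, ...} u {oo}: [Some n] is n and [None] is oo.           *)
Definition enat := option nat.

Definition nat_max (P : nat -> Prop) : enat :=
  if pselect (exists m, P m /\ forall n, P n -> (n <= m)%N) is left e
  then Some (projT1 (cid e)) else None.

Definition nat_ub (P : nat -> Prop) (b : nat) : Prop :=
  forall n, P n -> (n <= b)%N.

Definition nat_sup (P : nat -> Prop) : enat :=
  if pselect (exists m, nat_ub P m /\ forall b, nat_ub P b -> (m <= b)%N)
    is left e
  then Some (projT1 (cid e)) else None.

Definition cd (K : fieldType) (g : lieAlgType K) : enat :=
  nat_max (fun n => exists (M : lieModType g) (c : cohomology M n), c <> 0).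

Definition cd_hom (K : fieldType) (g h : lieAlgType K) (phi : lieHom g h) :
    enat :=
  nat_sup (fun n => exists (M : lieModType h) (c : cohomology M n),
    induced_map phi c <> 0).

(* Main.v *)
Require Import Defs.
From HB Require Import structures.
From mathcomp Require Import all_boot all_algebra.
From mathcomp Require Import boolp classical_sets functions.

Set Implicit Arguments.
Unset Strict Implicit.
Unset Printing Implicit Defensive.

(* Let N be a g-module, M = Hom_U(g)(U(h), N) the coinduced h-module and      *)
(* ev : M -> N the evaluation at 1, a map of g-modules. Every g-cocycle f     *)
(* with values in N equals ev (phi^* F) for some h-cocycle F with values in   *)
(* M, so phi^* [F] is nonzero as soon as [f] is; hence                        *)
(* cd(phi) and cd(g) are extrema of the same set of degrees.                  *)
(*   F amounts to a U(g)-linear map U(h) (x) L^n h -> N vanishing on          *)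
(* boundaries. It is built by induction on the filtration of U(h) by word     *)
(* length: the obstruction to the next step is a Koszul cocycle on            *)
(* S(h/g) (x) L^(n+1) h, hence a coboundary. No PBW basis is needed, since    *)
(* the extension of a U(g)-linear map from words of length <= k to words of   *)
(* length <= k + 1, which PBW would provide, follows by induction on k from   *)
(* the same obstruction argument for n = 1.                                   *)

Import GRing.Theory.
Local Open Scope ring_scope.
Local Open Scope quotient_scope.

(** The two dimensions are extrema of sets of degrees, and these sets coincide. A nonzero
    [induced_map phi c] is itself a nonzero class of g. Conversely, [coind_surjective] lifts every
    cocycle of g with values in N to a cocycle of h with values in the coinduced module: the
    surjective half of Shapiro's lemma, on the level of cocycles. Degree 0 always occurs
    ([trivial_H0]), so supremum and maximum agree ([nat_sup_max]).

    The lift is built in [cocycle_extend] by induction on word length. Going from length k to k + 1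
    takes two moves: [wordfun_extend] extends the U(g)-linear map without regard to the
    differential, and [cocycle_correction] alters it on words of length k + 1 so that the
    differential vanishes on words of length k. The defect to be removed is symmetric in the
    letters, because commutators shorten words; it vanishes on letters from g; and by [dlist_dlist]
    it is closed for the Koszul differential. The Koszul complex with letters in h/g and arguments
    in h has cohomology in word length 0 only, where it is detected on arguments from g
    ([koszul_exact]); there the defect is the differential of the given cocycle, hence 0.

    In [wordfun_extend] the same correction is applied to the 1-cochain y |-> (w |-> u (y :: w)),
    whose closedness is the bracket relation for the first two letters of a word. *)

(** * Zorn's lemma for functions defined on a growing subset *)

(** Read [G W s] as: s is good at the indices supported in W, its other values being junk. The
    second hypothesis makes [G] insensitive to the junk and of finite character, so that it passes
    to unions of chains; the third forces a maximal domain to be everything. *)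
Lemma zorn_extension (T : eqType) (I X : Type) (supp : I -> seq T)
    (G : pred T -> (I -> X) -> Prop) (W0 : pred T) (s0 : I -> X) :
    G W0 s0 ->
    (forall W s,
       (forall l, all W l -> exists W' s', [/\ G W' s', subpred W' W, all W' l &
          forall i, all W' (supp i) -> s' i = s i]) -> G W s) ->
    (forall W s v, G W s -> ~~ W v -> exists W' s', [/\ G W' s', subpred W W',
       W' v & forall i, all W (supp i) -> s' i = s i]) ->
  exists s, G predT s.
Proof.
move=> G0 Gloc Gstep.
pose P := {t : pred T * (I -> X) | `[< G t.1 t.2 >]}.
pose dom (t : P) := (val t).1; pose fn (t : P) := (val t).2.
have GP t : G (dom t) (fn t) by apply/asboolP; exact: (valP t).
have mkP W s : G W s -> exists t : P, dom t = W /\ fn t = s.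
  by move=> /asboolP Gs; exists (exist _ (W, s) Gs).
pose le (t u : P) := `[< subpred (dom t) (dom u) /\
  forall i, all (dom t) (supp i) -> fn u i = fn t i >].
have [t0 _] := mkP _ _ G0.
have [||A tA|t tmax] := @ZL_preorder P t0 le.
- by move=> t; apply/asboolP; split.
- move=> u t r /asboolP[ut ut'] /asboolP[tr tr']; apply/asboolP; split.
    by move=> x /ut /tr.
  by move=> i ui; rewrite tr' ?ut' //; exact: sub_all ui.
- have [[t1 At1]|A0] := pselect (exists t, A t); last first.
    by exists t0 => s As; case: A0; exists s.
  pose W := [pred x | `[< exists2 t, A t & dom t x >]].
  have cover l : all W l -> exists2 t, A t & all (dom t) l.
    elim: l => [|x l IH] /=; first by exists t1.
    move=> /andP[/asboolP[t At tx] /IH[u Au ul]].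
    have [] := tA t u At Au => /asboolP[sub _].
      by exists u => //; rewrite (sub _ tx).
    by exists t; rewrite // tx; exact: sub_all ul.
  (* All members of the chain that cover [supp i] give the same value; [s0] only fills in junk. *)
  pose s i := if pselect (exists2 t, A t & all (dom t) (supp i)) is left e
    then fn (projT1 (cid2 e)) i else s0 i.
  have sE t i : A t -> all (dom t) (supp i) -> s i = fn t i.
    move=> At ti; rewrite /s; case: pselect => [e|[]]; last by exists t.
    case: cid2 => u Au ui /=.
    have [] := tA t u At Au => /asboolP[_ -> //].
  have Wt t : A t -> subpred (dom t) W.
    by move=> At x tx; apply/asboolP; exists t.
  have /mkP[u [uW us]] : G W s.
    apply: Gloc => l /cover[t At tl]; exists (dom t), (fn t); split => //.
      exact: Wt.
    by move=> i /(sE _ _ At).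
  exists u => t At; apply/asboolP; rewrite uW us; split; first exact: Wt.
  by move=> i /(sE _ _ At).
- exists (fn t); have := GP t; rewrite (_ : dom t = predT) //.
  apply/funext => v /=; case: (boolP (dom t v)) => // tv.
  have [W' [s' [/mkP[u [<- <-]] sub uv tu]]] := Gstep _ _ v (GP t) tv.
  have /tmax/asboolP[/(_ v uv)] : le t u by apply/asboolP.
  by rewrite (negPf tv).
Qed.

(** * Linear complements *)

Section LinearComplement.
Variables (K : fieldType) (V : lmodType K).

Definition lin_closed (W : pred V) :=
  forall a u v, W u -> W v -> W (a *: u + v).

Lemma lin_closed0 W u : lin_closed W -> W u -> W 0.
Proof. by move=> /(_ (-1) u u) + Wu => /(_ Wu Wu); rewrite scaleN1r addNr. Qed.

Lemma lin_closedZ W a u : lin_closed W -> W u -> W (a *: u).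
Proof. by move=> Wc Wu; rewrite -[a *: u]addr0 Wc ?(lin_closed0 Wc Wu). Qed.

Variables (W : pred V) (v : V).
Hypotheses (Wc : lin_closed W) (W0 : W 0) (Wv : ~~ W v).

(** On W + K v, [adj_coef] and [adj_proj] are the coordinates along v and along W, unique because v
    lies outside W. Elsewhere the coefficient defaults to 0. *)
Definition adjoin : pred V := fun y : V => `[< exists c : K, W (y - c *: v) >].
Definition adj_coef (y : V) : K := xget 0 [set c : K | W (y - c *: v)].
Definition adj_proj (y : V) : V := y - adj_coef y *: v.

Lemma adjoin_decomp (y : V) : y = adj_coef y *: v + adj_proj y.
Proof. by rewrite /adj_proj addrC subrK. Qed.

Lemma adj_projW y : adjoin y -> W (adj_proj y).
Proof.
move=> /asboolP[c Wc']; rewrite /adj_proj /adj_coef.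
by case: xgetP => // /(_ c).
Qed.

Lemma adj_coef_unique y c : W (y - c *: v) -> adj_coef y = c.
Proof.
move=> Wy; have /adj_projW Wp : adjoin y by apply/asboolP; exists c.
apply/eqP; rewrite -subr_eq0; apply: contraNT Wv => nz.
have := Wc (-1) Wp Wy; rewrite scaleN1r opprB addrA subrK -scalerBl.
move=> /(lin_closedZ (adj_coef y - c)^-1 Wc).
by rewrite scalerA mulVf ?scale1r.
Qed.

Lemma adj_coefW y : W y -> adj_coef y = 0.
Proof. by move=> Wy; apply: adj_coef_unique; rewrite scale0r subr0. Qed.

Lemma adj_projK y : W y -> adj_proj y = y.
Proof. by move=> Wy; rewrite /adj_proj adj_coefW // scale0r subr0. Qed.

Lemma adj_coefv : adj_coef v = 1.
Proof. by apply: adj_coef_unique; rewrite scale1r subrr. Qed.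

Lemma adj_projv : adj_proj v = 0.
Proof. by rewrite /adj_proj adj_coefv scale1r subrr. Qed.

Lemma adj_coefP a y z : adjoin y -> adjoin z ->
  adj_coef (a *: y + z) = a * adj_coef y + adj_coef z.
Proof.
move=> /adj_projW Wy /adj_projW Wz; apply: adj_coef_unique.
by have := Wc a Wy Wz; rewrite scalerBr scalerA addrACA -opprD scalerDl.
Qed.

Lemma adj_projP a y z : adjoin y -> adjoin z ->
  adj_proj (a *: y + z) = a *: adj_proj y + adj_proj z.
Proof.
move=> Ay Az; rewrite /adj_proj adj_coefP //.
by rewrite scalerBr scalerA addrACA -opprD scalerDl.
Qed.

Lemma sub_adjoin : subpred W adjoin.
Proof. by move=> y Wy; apply/asboolP; exists 0; rewrite scale0r subr0. Qed.

Lemma adjoin_mem : adjoin v.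
Proof. by apply/asboolP; exists 1; rewrite scale1r subrr. Qed.

Lemma adjoin_closed : lin_closed adjoin.
Proof.
move=> a y z Ay Az; apply/asboolP; exists (adj_coef (a *: y + z)).
by rewrite -/(adj_proj _) adj_projP // Wc // adj_projW.
Qed.

End LinearComplement.

Lemma linear_retraction (K : fieldType) (U V : lmodType K)
    (phi : {linear U -> V}) :
  injective phi -> exists2 p : V -> U, linear p & cancel phi p.
Proof.
move=> phi_inj.
pose G (W : pred V) (p : V -> U) :=
  [/\ lin_closed W, cancel phi p, forall x, W (phi x) &
    forall a u v, W u -> W v -> p (a *: u + v) = a *: p u + p v].
pose W0 : pred V := fun y => `[< exists x, y = phi x >].
have inW0 x : W0 (phi x) by apply/asboolP; exists x.
pose p0 y : U := if pselect (exists x, y = phi x) is left e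
  then projT1 (cid e) else 0.
have p0K : cancel phi p0.
  move=> x; rewrite /p0; case: pselect => [e|[]]; last by exists x.
  by case: cid => z /= /phi_inj.
have [|||p [_ pK _ plin]] :=
    @zorn_extension V V U (fun y => [:: y]) G W0 p0; last 1 first.
- by exists p => // a u v; rewrite plin.
- split=> // a _ _ /asboolP[x ->] /asboolP[y ->].
    by rewrite -linearP.
  by rewrite -linearP !p0K.
- move=> W p loc; split.
  + move=> a u v Wu Wv; have [|W' [p' [[W'c _ _ _] sub]]] := loc [:: u; v].
      by rewrite /= Wu Wv.
    by move=> /and3P[W'u W'v _] _; apply/sub/W'c.
  + move=> x; have [//|W' [p' [[_ p'K W'phi _] _ _]]] := loc [::].
    by move=> /(_ (phi x)) <-; rewrite ?p'K //= W'phi.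
  + by move=> x; have [//|W' [p' [[_ _ W'phi _] sub _ _]]] := loc [::]; apply: sub.
  + move=> a u v Wu Wv.
    have [|W' [p' [[W'c _ _ lin] _]]] := loc [:: u; v]; first by rewrite /= Wu Wv.
    move=> /and3P[W'u W'v _] pE.
    by rewrite -!pE /= ?W'u ?W'v ?W'c // lin.
- move=> W p v [Wc pK Wphi plin] Wv.
  have W0' : W 0 by rewrite -(linear0 phi).
  (* The extension sends v to 0. *)
  exists (adjoin W v), (p \o adj_proj W v); split.
  + split.
    * exact: adjoin_closed.
    * by move=> x /=; rewrite adj_projK.
    * by move=> x; apply: sub_adjoin.
    * by move=> a y z Ay Az /=; rewrite adj_projP // plin // adj_projW.
  + exact: sub_adjoin.
  + exact: adjoin_mem.
  + by move=> y /andP[Wy _] /=; rewrite adj_projK.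
Qed.

(** * Exactness of the Koszul complex *)

Section Koszul.
Variables (K : fieldType) (U V N : lmodType K) (phi : {linear U -> V}).
Implicit Types (W : pred V) (s e : seq V -> seq V -> N) (w ys p q : seq V).

(* asum f [:: y_0; ..; y_n] is the sum of the (-1)^i f y_i (.. ^y_i ..).        *)
Fixpoint asum (f : V -> seq V -> N) ys : N :=
  if ys is y :: t then f y t - asum (fun z t' => f z (y :: t')) t else 0.

(** The transpose of the Koszul differential, which sends the word w with arguments y_0, .., y_n to
    the sum of the (-1)^i y_i w with arguments (.. ^y_i ..). *)
Definition koszul s w ys := asum (fun y => s (y :: w)) ys.

(* On words w and argument lists ys over W, s is a linear form on             *)
(* S(W / phi U) (x) L(W), all degrees at once.                                *)
Record sym_alt W s : Prop := {
  sa_lin : forall p q a u v ys, all W (u :: v :: p ++ q ++ ys) ->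
    s (p ++ a *: u + v :: q) ys = a *: s (p ++ u :: q) ys + s (p ++ v :: q) ys;
  sa_sym : forall p q u v ys, all W (u :: v :: p ++ q ++ ys) ->
    s (p ++ u :: v :: q) ys = s (p ++ v :: u :: q) ys;
  sa_ker : forall p q x ys, all W (p ++ q ++ ys) -> s (p ++ phi x :: q) ys = 0;
  sa_altlin : forall w p q a u v, all W (u :: v :: p ++ q ++ w) ->
    s w (p ++ a *: u + v :: q) = a *: s w (p ++ u :: q) + s w (p ++ v :: q);
  sa_alt : forall w p q u, all W (u :: p ++ q ++ w) ->
    s w (p ++ u :: u :: q) = 0
}.

Lemma koszulS s w y t :
  koszul s w (y :: t) = s (y :: w) t - koszul (fun w t => s w (y :: t)) w t.
Proof. by []. Qed.

Lemma eq_asum W f f' ys :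
  (forall y t, W y -> all W t -> f y t = f' y t) ->
  all W ys -> asum f ys = asum f' ys.
Proof.
elim: ys f f' => //= y ys IH f f' ff' /andP[Wy Wys].
rewrite ff' // (IH _ (fun z t => f' z (y :: t))) // => z t Wz Wt.
by rewrite ff' //= Wy.
Qed.

Lemma asum0 ys : asum (fun _ _ => 0) ys = 0.
Proof. by elim: ys => //= y ys ->; rewrite subr0. Qed.

Lemma asumP a f f' ys :
  asum (fun y t => a *: f y t + f' y t) ys = a *: asum f ys + asum f' ys.
Proof.
elim: ys f f' => /= [|y ys IH] f f'; first by rewrite scaler0 addr0.
by rewrite IH scalerBr opprD addrACA.
Qed.

Section Stable.
Variable W : pred V.

Lemma sa_word s y : W y -> sym_alt W s -> sym_alt W (fun w => s (y :: w)).
Proof.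
move=> Wy [sl ss sk al aa].
split=> [p q a u v ys|p q u v ys|p q x ys|w p q a u v|w p q u].
- by move=> /and3P[Wu Wv H]; apply: (sl (y :: p)); rewrite /= Wu Wv Wy.
- by move=> /and3P[Wu Wv H]; apply: (ss (y :: p)); rewrite /= Wu Wv Wy.
- by move=> H; apply: (sk (y :: p)); rewrite /= Wy.
- rewrite /= !all_cat => /and5P[Wu Wv Wp Wq Ww]; apply: al.
  by rewrite /= !all_cat /= Wu Wv Wp Wq Wy.
- rewrite /= !all_cat => /and4P[Wu Wp Wq Ww]; apply: aa.
  by rewrite /= !all_cat /= Wu Wp Wq Wy.
Qed.

Lemma sa_arg s y : W y -> sym_alt W s -> sym_alt W (fun w t => s w (y :: t)).
Proof.
move=> Wy [sl ss sk al aa].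
split=> [p q a u v ys|p q u v ys|p q x ys|w p q a u v|w p q u].
- rewrite /= !all_cat => /and5P[Wu Wv Wp Wq Ww]; apply: sl.
  by rewrite /= !all_cat /= Wu Wv Wp Wq Wy.
- rewrite /= !all_cat => /and5P[Wu Wv Wp Wq Ww]; apply: ss.
  by rewrite /= !all_cat /= Wu Wv Wp Wq Wy.
- rewrite !all_cat => /and3P[Wp Wq Ww]; apply: sk.
  by rewrite !all_cat /= Wp Wq Wy.
- by move=> /and3P[Wu Wv H]; apply: (al _ (y :: p)); rewrite /= Wu Wv Wy.
- by move=> /andP[Wu H]; apply: (aa _ (y :: p)); rewrite /= Wu Wy.
Qed.

Lemma saP a s s' : sym_alt W s -> sym_alt W s' ->
  sym_alt W (fun w t => a *: s w t + s' w t).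
Proof.
move=> [sl ss sk al aa] [sl' ss' sk' al' aa'].
split=> [p q b u v ys|p q u v ys|p q x ys|w p q b u v|w p q u] H.
- by rewrite sl // sl' // !scalerDr !scalerA mulrC addrACA.
- by rewrite ss // ss'.
- by rewrite sk // sk' // scaler0 addr0.
- by rewrite al // al' // !scalerDr !scalerA mulrC addrACA.
- by rewrite aa // aa' // scaler0 addr0.
Qed.

Lemma koszul_word s y w ys : sym_alt W s -> W y -> all W w -> all W ys ->
  koszul s (y :: w) ys = koszul (fun w => s (y :: w)) w ys.
Proof.
move=> sa Wy Ww Wys; apply: eq_asum Wys => z t Wz Wt.
by apply: (sa_sym sa (p := [::])); rewrite /= Wz Wy all_cat Ww.
Qed.

Lemma sa_koszul s : sym_alt W s -> sym_alt W (koszul s).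
Proof.
move=> sa; split=> [p q a u v ys|p q u v ys|p q x ys|w p q a u v|w p q u].
- rewrite /= !all_cat => /and5P[Wu Wv Wp Wq Wys].
  rewrite -asumP; apply: eq_asum Wys => y t Wy Wt.
  by apply: (sa_lin sa (p := y :: p)); rewrite /= !all_cat Wu Wv Wy Wp Wq.
- rewrite /= !all_cat => /and5P[Wu Wv Wp Wq Wys].
  apply: eq_asum Wys => y t Wy Wt.
  by apply: (sa_sym sa (p := y :: p)); rewrite /= !all_cat Wu Wv Wy Wp Wq.
- rewrite !all_cat => /and3P[Wp Wq Wys].
  rewrite -(asum0 ys); apply: eq_asum Wys => y t Wy Wt.
  by apply: (sa_ker sa (p := y :: p)); rewrite /= !all_cat Wy Wp Wq.
- rewrite /= !all_cat => /and5P[Wu Wv + Wq Ww].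
  elim: p s sa => [|y p IH] s sa /=.
    move=> _; rewrite /koszul /= (sa_lin sa (p := [::])) /=; last first.
      by rewrite Wu Wv all_cat Ww.
    rewrite (@eq_asum W _
      (fun y t => a *: s (y :: w) (u :: t) + s (y :: w) (v :: t))) //.
      by rewrite asumP scalerBr opprD addrACA.
    move=> y t Wy Wt; rewrite (sa_altlin sa (p := [::])) //=.
    by rewrite Wu Wv all_cat /= Wy Wt.
  move=> /andP[Wy Wp]; rewrite !koszulS IH //; last exact: sa_arg.
  rewrite (sa_altlin sa); last by rewrite /= !all_cat /= Wu Wv Wp Wq Wy.
  by rewrite scalerBr opprD addrACA.
- rewrite /= !all_cat => /and4P[Wu + Wq Ww].
  elim: p s sa => [|y p IH] s sa /=.
    move=> _; rewrite !koszulS opprB addrCA subrr addr0.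
    rewrite -(asum0 q); apply: eq_asum Wq => y t Wy Wt.
    by rewrite (sa_alt sa (p := [::])) //= Wu all_cat /= Wy Wt.
  move=> /andP[Wy Wp]; rewrite koszulS IH //; last exact: sa_arg.
  by rewrite (sa_alt sa) ?subr0 // /= !all_cat /= Wu Wp Wq Wy.
Qed.

(** Letters commute while removed arguments carry opposite signs. In the induction the terms that
    move the first argument y cancel by symmetry of the word, and the rest is the same statement for
    s contracted with y. *)
Lemma koszul_koszul s w ys : sym_alt W s -> all W w -> all W ys ->
  koszul (koszul s) w ys = 0.
Proof.
elim: ys s => //= y ys IH s sa Ww /andP[Wy Wys].
have IHy : asum (fun z => koszul (fun w t => s w (y :: t)) (z :: w)) ys = 0.
  by apply: (IH _ _ Ww Wys); exact: sa_arg.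
have := asumP (-1) (fun z => koszul (fun w t => s w (y :: t)) (z :: w))
  (fun z => s (y :: z :: w)) ys.
rewrite IHy scaler0 add0r koszulS koszul_word // => {IHy}/esym E.
apply/eqP; rewrite subr_eq0; apply/eqP; rewrite -[LHS]/(asum _ _) {}E.
by apply: eq_asum Wys => z t Wz Wt; rewrite koszulS scaleN1r addrC.
Qed.

End Stable.

Lemma sub_sym_alt W W' s : subpred W W' -> sym_alt W' s -> sym_alt W s.
Proof.
move=> sub [sl ss sk al aa].
split=> [p q a u v ys|p q u v ys|p q x ys|w p q a u v|w p q u] /(sub_all sub).
- exact: sl. - exact: ss. - exact: sk. - exact: al. - exact: aa.
Qed.

Section OneStep.
Variables (W : pred V) (v : V).
Hypotheses (Wc : lin_closed W) (Wphi : forall x, W (phi x)) (Wv : ~~ W v).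

Let W' := adjoin W v.
Let mu := adj_coef W v.
Let pr := adj_proj W v.
Let W0 : W 0. Proof. by rewrite -(linear0 phi). Qed.
Let sub : subpred W W'. Proof. exact: sub_adjoin. Qed.
Let W'c : lin_closed W'. Proof. exact: adjoin_closed. Qed.
Let W'v : W' v. Proof. exact: adjoin_mem. Qed.
Let Wpr y : W' y -> W (pr y). Proof. exact: adj_projW. Qed.
Let W'pr y : W' y -> W' (pr y). Proof. by move=> /Wpr/sub. Qed.

(** Pulling back along the projection of W + K v onto W extends s; the projection fixes the image of
    phi, which lies in W. *)
Lemma sa_proj s : sym_alt W s ->
  sym_alt W' (fun w ys => s (map pr w) (map pr ys)).
Proof.
have mapW l : all W' l -> all W (map pr l).
  by move=> Wl; rewrite all_map; apply: sub_all Wl => y /Wpr.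
move=> [sl ss sk al aa].
split=> [p q a x y ys|p q x y ys|p q x ys|w p q a x y|w p q x];
  rewrite /= !map_cat /=.
- move=> /and3P[Wx Wy /mapW]; rewrite /pr adj_projP // -/pr !map_cat => H.
  by apply: sl; rewrite /= !Wpr.
- move=> /and3P[Wx Wy /mapW]; rewrite !map_cat => H.
  by apply: ss; rewrite /= !Wpr.
- by move=> /mapW; rewrite !map_cat /pr adj_projK // => H; apply: sk.
- move=> /and3P[Wx Wy /mapW]; rewrite /pr adj_projP // -/pr !map_cat => H.
  by apply: al; rewrite /= !Wpr.
- move=> /andP[Wx /mapW]; rewrite !map_cat => H.
  by apply: aa; rewrite /= Wpr.
Qed.

Lemma map_prW l : all W l -> map pr l = l.
Proof. by elim: l => //= y l IH /andP[Wy /IH ->]; rewrite /pr adj_projK. Qed.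

(* The contracting homotopy moves a factor v from S(V) to L(V).               *)
Fixpoint htpy e w ys : N :=
  if w is y :: w then mu y *: e w (v :: ys) + htpy (fun w => e (pr y :: w)) w ys
  else 0.

Lemma eq_htpy e e' w ys :
  (forall w t, all W' w -> all W' t -> e w t = e' w t) ->
  all W' w -> all W' ys -> htpy e w ys = htpy e' w ys.
Proof.
elim: w e e' => //= y w IH e e' ee' /andP[Wy Ww] Wys.
rewrite ee' //= ?W'v // (IH _ (fun w => e' (pr y :: w))) // => x t Wx Wt.
by rewrite ee' //= W'pr.
Qed.

Lemma htpyP a e e' w ys :
  htpy (fun w t => a *: e w t + e' w t) w ys = a *: htpy e w ys + htpy e' w ys.
Proof.
elim: w e e' => /= [|y w IH] e e'; first by rewrite scaler0 addr0.
by rewrite IH !scalerDr !scalerA mulrC addrACA.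
Qed.

Lemma htpy0 w ys : htpy (fun _ _ => 0) w ys = 0.
Proof. by elim: w => //= y w ->; rewrite scaler0 addr0. Qed.

Lemma htpyW e w ys : all W w -> htpy e w ys = 0.
Proof.
elim: w e => //= y w IH e /andP[Wy Ww].
by rewrite IH // /mu adj_coefW // scale0r addr0.
Qed.

(** Letters before the removed one are projected to W, so on v^a w with w over W the result is e on
    v^(a-1) w, without the factor a of a derivation, which could vanish in positive characteristic.
    Symmetry reappears on splitting the neighbouring letter into its parts along v and W. *)
Lemma sa_htpy e : sym_alt W' e -> sym_alt W' (htpy e).
Proof.
move=> sa; split=> [p q a x y ys|p q x y ys|p q x ys|w p q a x y|w p q x].
- rewrite /= !all_cat => /and5P[Wx Wy + Wq Wys].
  elim: p e sa => [|z p IH] e sa /=.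
    move=> _; rewrite /mu /pr adj_coefP // adj_projP // -/mu -/pr.
    rewrite (@eq_htpy _ (fun w t => a *: e (pr x :: w) t + e (pr y :: w) t)) //.
      by rewrite htpyP scalerDl !scalerDr !scalerA addrACA.
    move=> w t Ww Wt; apply: (sa_lin sa (p := [::])).
    by rewrite /= !W'pr // all_cat Ww.
  move=> /andP[Wz Wp].
  rewrite (sa_lin sa); last by rewrite /= Wx Wy !all_cat Wp Wq /= W'v.
  rewrite IH //; last exact/sa_word/sa/W'pr.
  by rewrite !scalerDr !scalerA mulrC addrACA.
- rewrite /= !all_cat => /and5P[Wx Wy + Wq Wys].
  elim: p e sa => [|z p IH] e sa /=.
    move=> _.
    have e1 z : W' z -> e (z :: q) (v :: ys) =
        mu z *: e (v :: q) (v :: ys) + e (pr z :: q) (v :: ys).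
      move=> Wz; rewrite {1}(adjoin_decomp W v z).
      by rewrite (sa_lin sa (p := [::])) // /= W'v W'pr // all_cat Wq /= W'v.
    rewrite (e1 x) // (e1 y) // !scalerDr !scalerA (mulrC (mu y)).
    rewrite (@eq_htpy (fun w => e (pr x :: pr y :: w))
      (fun w => e (pr y :: pr x :: w))) //.
      by rewrite !addrA; congr (_ + _); rewrite addrAC.
    move=> w t Ww Wt; apply: (sa_sym sa (p := [::])).
    by rewrite /= !W'pr // all_cat Ww.
  move=> /andP[Wz Wp].
  rewrite (sa_sym sa); last by rewrite /= Wx Wy !all_cat Wp Wq /= W'v.
  by rewrite IH //; exact/sa_word/sa/W'pr.
- rewrite !all_cat => /and3P[+ Wq Wys].
  elim: p e sa => [|z p IH] e sa /=.
    move=> _; rewrite /mu /pr adj_coefW // adj_projK // scale0r add0r.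
    rewrite -(htpy0 q ys); apply: eq_htpy => // w t Ww Wt.
    by apply: (sa_ker sa (p := [::])); rewrite /= all_cat Ww.
  move=> /andP[Wz Wp]; rewrite IH //; last exact/sa_word/sa/W'pr.
  by rewrite (sa_ker sa) ?scaler0 ?addr0 // !all_cat Wp Wq /= W'v.
- rewrite /= !all_cat => /and5P[Wx Wy Wp Wq].
  elim: w e sa => [|z w IH] e sa /=; first by rewrite scaler0 addr0.
  move=> /andP[Wz Ww].
  rewrite (sa_altlin sa (p := v :: p)); last by rewrite /= Wx Wy W'v !all_cat Wp Wq.
  rewrite IH //; last exact/sa_word/sa/W'pr.
  by rewrite !scalerDr !scalerA mulrC addrACA.
- rewrite /= !all_cat => /and4P[Wx Wp Wq].
  elim: w e sa => //= z w IH e sa /andP[Wz Ww].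
  rewrite (sa_alt sa (p := v :: p)); last by rewrite /= Wx W'v !all_cat Wp Wq.
  by rewrite IH ?scaler0 ?addr0 //; exact/sa_word/sa/W'pr.
Qed.

Lemma sa_front s p y q ys : sym_alt W' s -> W' y -> all W' p -> all W' q ->
  all W' ys -> s (p ++ y :: q) ys = s (y :: p ++ q) ys.
Proof.
move=> sa Wy + Wq Wys; elim: p s sa => //= z p IH s sa /andP[Wz Wp].
rewrite (IH (fun w => s (z :: w))) //; last exact: sa_word.
by apply: (sa_sym sa (p := [::])); rewrite /= Wz Wy !all_cat Wp Wq.
Qed.

(** Alternation at v + z exchanges v with its neighbour z up to sign, which brings v to the
    front. *)
Lemma sa_altfront s p q w : sym_alt W' s -> all W' p -> all W' q -> all W' w ->
  (forall t, all W' t -> s w (v :: t) = 0) -> s w (p ++ v :: q) = 0.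
Proof.
move=> sa + Wq Ww; elim/last_ind: p q Wq => [|p z IH] q Wq.
  by move=> _ ->.
rewrite all_rcons => /andP[Wz Wp] sv0; rewrite -cats1 -catA /=.
have {}IH t : all W' t -> s w (p ++ v :: t) = 0 by move=> Wt; apply: IH.
have Wvz : W' (1 *: v + z) by rewrite W'c.
have : s w (p ++ (1 *: v + z) :: (1 *: v + z) :: q) = 0.
  by apply: (sa_alt sa); rewrite /= Wvz !all_cat Wp Wq Ww.
rewrite (sa_altlin sa); last by rewrite /= W'v Wz !all_cat /= all_cat Wvz Wp Wq.
rewrite IH /= ?Wvz // scaler0 add0r.
have := @sa_altlin _ _ sa w (p ++ [:: z]) q 1 v z.
rewrite /= -!catA /= all_cat /= all_cat W'v Wz Wp Wq Ww => -> //.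
by rewrite (sa_alt sa) /= ?Wz ?all_cat ?Wp ?Wq // scale1r addr0.
Qed.

Lemma sa_eq0 s : sym_alt W' s ->
    (forall w ys, all W' w -> all W' ys -> s (v :: w) ys = 0) ->
    (forall w ys, all W w -> all W' ys -> s w (v :: ys) = 0) ->
    (forall w ys, all W w -> all W ys -> s w ys = 0) ->
  forall w ys, all W' w -> all W' ys -> s w ys = 0.
Proof.
move=> sa sv svy sW w ys Ww Wys.
have subs l : all W l -> all W' l := sub_all sub (s := l).
have WWpr l : all W' l -> all W (map pr l).
  by move=> Wl; rewrite all_map; apply: sub_all Wl => y /Wpr.
have -> : s w ys = s (map pr w) ys.
  suff /(_ [::]) : forall q, all W' q ->
    s (q ++ w) ys = s (q ++ map pr w) ys by exact.
  elim: w Ww => //= y w IH /andP[Wy Ww] q Wq.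
  rewrite {1}(adjoin_decomp W v y) (sa_lin sa); last first.
    by rewrite /= W'v W'pr // !all_cat Wq Ww.
  rewrite sa_front // sv ?all_cat ?Wq // scaler0 add0r -!cat_rcons IH //.
  by rewrite all_rcons Wq W'pr.
move/WWpr in Ww; have W'w := subs _ Ww.
rewrite -[RHS](sW _ _ Ww (WWpr _ Wys)).
suff /(_ [::]) : forall q, all W' q ->
  s (map pr w) (q ++ ys) = s (map pr w) (q ++ map pr ys) by exact.
elim: ys Wys => //= y ys IH /andP[Wy Wys] q Wq.
rewrite {1}(adjoin_decomp W v y) (sa_altlin sa); last first.
  by rewrite /= W'v W'pr // !all_cat Wq Wys.
rewrite (@sa_altfront s q ys _ sa Wq Wys W'w) => [|t Wt]; last exact: svy.
rewrite scaler0 add0r -!cat_rcons IH //.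
by rewrite all_rcons Wq W'pr.
Qed.

(** By [sa_eq0] three cases remain. If v is in the word, [htpy] removes it and closedness of e with
    v as an extra argument gives the identity. If v is only among the arguments, moving it into the
    word returns e and all other terms repeat v. If v is absent, both sides vanish. *)
Lemma koszul_htpy e : sym_alt W' e ->
    (forall w ys, all W' w -> all W' ys -> koszul e w ys = 0) ->
    (forall w ys, all W w -> all W ys -> e w ys = 0) ->
  forall w ys, all W' w -> all W' ys -> koszul (htpy e) w ys = e w ys.
Proof.
move=> sa ke eW w ys Ww Wys; have sah := sa_htpy sa.
have e0 x t : all W' x -> all W' t -> e (pr v :: x) t = 0.
  move=> Wx Wt; rewrite /pr adj_projv // -(linear0 phi).
  by apply: (sa_ker sa (p := [::])); rewrite /= all_cat Wx.
have hv x t : all W' x -> all W' t -> htpy e (v :: x) t = e x (v :: t).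
  move=> Wx Wt /=; rewrite /mu adj_coefv // scale1r -[RHS]addr0; congr (_ + _).
  by rewrite -(htpy0 x t); apply: eq_htpy.
suff D0 : -1 *: e w ys + koszul (htpy e) w ys = 0.
  by move/eqP: D0; rewrite scaleN1r addrC subr_eq0 => /eqP.
have subW l : all W l -> all W' l := sub_all sub (s := l).
apply: (sa_eq0 (s := fun w t => -1 *: e w t + koszul (htpy e) w t)) Ww Wys.
- exact/saP/sa_koszul.
- move=> x t Wx Wt; have := ke x (v :: t) Wx.
  rewrite koszulS /= W'v Wt => /(_ isT)/eqP; rewrite subr_eq0 => /eqP ->.
  apply/eqP; rewrite scaleN1r addrC subr_eq0; apply/eqP.
  apply: eq_asum Wt => y r Wy Wr.
  rewrite (sa_sym sah (p := [::])) /= ?Wy ?W'v ?all_cat ?Wx //.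
  by rewrite -[LHS]/(htpy e (v :: y :: x) r) hv //= Wy.
- move=> x t Wx Wt; rewrite koszulS hv //; last exact: subW.
  rewrite scaleN1r addKr.
  apply/eqP; rewrite oppr_eq0; apply/eqP; rewrite -(asum0 t).
  apply: eq_asum Wt => y r Wy Wr /=.
  rewrite htpyW // addr0 (sa_alt sa (p := [::])) ?scaler0 //.
  by rewrite /= W'v all_cat Wr subW.
- move=> x t Wx Wt; rewrite eW // scaler0 add0r -(asum0 t).
  by apply: eq_asum Wt => y r Wy Wr; rewrite htpyW //= Wy.
Qed.

End OneStep.

(* Zorn's lemma replaces a basis of V: a primitive defined on W is extended   *)
(* to W + K v with htpy.                                                      *)
Lemma koszul_exact e : sym_alt predT e ->
    (forall w ys, koszul e w ys = 0) ->
    (forall ys, all [pred y | `[< exists x, y = phi x >]] ys -> e [::] ys = 0) ->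
  exists2 s, sym_alt predT s & forall w ys, koszul s w ys = e w ys.
Proof.
move=> sae ke e0.
pose G (W : pred V) (s : seq V * seq V -> N) :=
  [/\ lin_closed W, forall x, W (phi x), sym_alt W (fun w ys => s (w, ys)) &
    forall w ys, all W w -> all W ys ->
      koszul (fun w ys => s (w, ys)) w ys = e w ys].
pose im : pred V := [pred y | `[< exists x, y = phi x >]].
have [|||s [_ _ sas ks]] := @zorn_extension V (seq V * seq V) N
    (fun i => i.1 ++ i.2) G im (fun=> 0); last 1 first.
- by exists (fun w ys => s (w, ys)) => // w ys; apply: ks; apply: all_predT.
- split=> [a _ _ /asboolP[x ->] /asboolP[y ->]|x||w ys Ww Wys].
  + by apply/asboolP; exists (a *: x + y); rewrite linearP.
  + by apply/asboolP; exists x.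
  + by split=> *; rewrite ?scaler0 ?addr0.
  + rewrite /koszul asum0; case: w Ww => [|y w /andP[/asboolP[x ->] _]].
      by rewrite e0.
    by rewrite (sa_ker sae (p := [::])) // all_predT.
- move=> W s loc; split.
  + move=> a u v Wu Wv; have [|W' [s' [[W'c _ _ _] sub]]] := loc [:: u; v].
      by rewrite /= Wu Wv.
    by move=> /and3P[W'u W'v _] _; apply/sub/W'c.
  + by move=> x; have [//|W' [p' [[_ W'phi _ _] sub _ _]]] := loc [::]; apply: sub.
  + split=> [p q a u v ys|p q u v ys|p q x ys|w p q a u v|w p q u]
      /loc[W' [s' [[W'c W'phi sa _] _ W'l sE]]].
    * have := sa_lin sa a W'l; move: W'l.
      rewrite /= !all_cat => /and5P[Wu Wv Wp Wq Wys].
      by rewrite !sE //= !all_cat /= ?Wp ?Wq ?Wys ?Wu ?Wv ?W'c.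
    * have := sa_sym sa W'l; move: W'l.
      rewrite /= !all_cat => /and5P[Wu Wv Wp Wq Wys].
      by rewrite !sE //= !all_cat /= ?Wp ?Wq ?Wys ?Wu ?Wv.
    * have := sa_ker sa x W'l; move: W'l.
      rewrite !all_cat => /and3P[Wp Wq Wys].
      by rewrite !sE //= !all_cat /= ?Wp ?Wq ?Wys ?W'phi.
    * have := sa_altlin sa a W'l; move: W'l.
      rewrite /= !all_cat => /and5P[Wu Wv Wp Wq Wys].
      by rewrite !sE //= !all_cat /= ?Wp ?Wq ?Wys ?Wu ?Wv ?W'c.
    * have := sa_alt sa W'l; move: W'l.
      rewrite /= !all_cat => /and4P[Wu Wp Wq Wys].
      by rewrite !sE //= !all_cat /= ?Wp ?Wq ?Wys ?Wu.
  + move=> w ys Ww Wys; have [|W' [s' [[W'c W'phi sa ks] _]]] := loc (w ++ ys).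
      by rewrite all_cat Ww.
    rewrite all_cat => /andP[W'w W'ys] sE; rewrite -ks //.
    apply: eq_asum W'ys => y t Wy Wt.
    by rewrite sE //= all_cat Wy W'w.
- move=> W s v [Wc Wphi sa ks] Wv.
  have W0 : W 0 by rewrite -(linear0 phi).
  pose s1 w ys := s (map (adj_proj W v) w, map (adj_proj W v) ys).
  have sa1 : sym_alt (adjoin W v) s1.
    exact: (@sa_proj W v Wc Wphi Wv (fun w ys => s (w, ys))).
  have sub := @sub_adjoin _ _ W v.
  have ac := adjoin_closed Wc Wv.
  have mapid l : all W l -> map (adj_proj W v) l = l by apply: map_prW.
  (* The defect left by [s1] is closed and vanishes on W, so [htpy] gives a primitive of it, itself
     0 on words over W. *)
  pose e1 w ys := -1 *: koszul s1 w ys + e w ys.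
  have aphi x : adjoin W v (phi x) by apply: sub.
  have sae1 : sym_alt (adjoin W v) e1.
    apply: saP; first exact: sa_koszul.
    exact: sub_sym_alt sae.
  exists (adjoin W v), (fun i => s1 i.1 i.2 + htpy W v e1 i.1 i.2); split.
  + split=> //.
      have := saP 1 sa1 (sa_htpy Wc Wphi Wv sae1).
      by under eq_fun do under eq_fun do rewrite scale1r.
    move=> w ys Ww Wys.
    have := asumP 1 (fun y => s1 (y :: w)) (fun y => htpy W v e1 (y :: w)) ys.
    rewrite scale1r -/(koszul s1 w ys) -/(koszul (htpy W v e1) w ys).
    rewrite koszul_htpy //.
    * rewrite /e1 scaleN1r addNKr => <-; rewrite /koszul.
      by under [in RHS]eq_fun do under eq_fun do rewrite scale1r.
    * move=> w' ys' Ww' Wys'; have := asumP (-1) (fun y => koszul s1 (y :: w'))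
        (fun y => e (y :: w')) ys'.
      rewrite -/(koszul e w' ys') ke addr0 => E.
      rewrite -[LHS]/(asum _ _) {}E.
      by rewrite -[X in _ *: X]/(koszul (koszul s1) w' ys')
        (koszul_koszul sa1) ?scaler0.
    * move=> w' ys' Ww' Wys'; rewrite /e1 -ks // scaleN1r; apply/eqP.
      rewrite addrC subr_eq0; apply/eqP; apply: eq_asum Wys' => y t Wy Wt.
      by rewrite /s1 !mapid //= Wy.
  + exact: sub.
  + exact: adjoin_mem.
  + move=> [w ys] /=; rewrite all_cat => /andP[Ww Wys].
    by rewrite htpyW // addr0 /s1 !mapid.
Qed.

End Koszul.

(** * Cochains on lists *)

Section BracketTheory.
Variables (K : fieldType) (h : lieAlgType K).
Implicit Types x y z : h.

Lemma bracket0r y : bracket y 0 = 0 :> h.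
Proof. by have := bracketPr (-1) y y y; rewrite scaleN1r addNr scaleN1r addNr. Qed.

Lemma bracketNr x y : bracket x (- y) = - bracket x y.
Proof. by have := bracketPr (-1) x y 0; rewrite !addr0 bracket0r !scaleN1r addr0. Qed.

Lemma bracketC x y : bracket y x = - bracket x y.
Proof.
apply/eqP; rewrite -addr_eq0; apply/eqP.
have := bracketxx (1 *: x + y); rewrite bracketPl !bracketPr !bracketxx !scale1r.
by rewrite add0r addr0 addrC.
Qed.

Lemma jacobi_ad x y z :
  bracket x (bracket y z) - bracket y (bracket x z) = bracket (bracket x y) z.
Proof.
have := jacobi x y z; rewrite (bracketC (bracket x y) z) (bracketC x z) bracketNr.
by move/eqP; rewrite subr_eq0 => /eqP.
Qed.

End BracketTheory.

Section ListCochains.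
Variables (K : fieldType) (h : lieAlgType K) (N : lmodType K).
Implicit Types (c : seq h -> N) (y z : h) (p q t w ys : seq h).
Implicit Types (r s : seq h -> seq h -> N).

Record alt_multilinear c : Prop := {
  am_lin : forall p q a u v,
    c (p ++ a *: u + v :: q) = a *: c (p ++ u :: q) + c (p ++ v :: q);
  am_alt : forall p q u, c (p ++ u :: u :: q) = 0
}.

Lemma am_cons c y : alt_multilinear c -> alt_multilinear (fun t => c (y :: t)).
Proof.
move=> [cl ca]; split=> [p q a u v|p q u].
  exact: (cl (y :: p)).
exact: (ca (y :: p)).
Qed.

Lemma amP a c c' : alt_multilinear c -> alt_multilinear c' ->
  alt_multilinear (fun t => a *: c t + c' t).
Proof.
move=> [cl ca] [cl' ca']; split=> [p q b u v|p q u].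
  by rewrite cl cl' !scalerDr !scalerA mulrC addrACA.
by rewrite ca ca' scaler0 addr0.
Qed.

Lemma am_head c a u v q : alt_multilinear c ->
  c (a *: u + v :: q) = a *: c (u :: q) + c (v :: q).
Proof. by move=> am; exact: (am_lin am [::]). Qed.

Lemma am0 c p q : alt_multilinear c -> c (p ++ 0 :: q) = 0.
Proof.
move=> [cl _]; have := cl p q (-1) 0 0.
by rewrite scaleN1r addNr scaleN1r addNr.
Qed.

Lemma am_swap c p q u v : alt_multilinear c ->
  c (p ++ u :: v :: q) = - c (p ++ v :: u :: q).
Proof.
move=> [cl ca]; apply/eqP; rewrite -addr_eq0; apply/eqP.
have := ca p q (1 *: u + v); rewrite cl.
have E x : c (p ++ x :: 1 *: u + v :: q) = c (p ++ x :: u :: q) + c (p ++ x :: v :: q).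
  by have := cl (rcons p x) q 1 u v; rewrite !cat_rcons => ->; rewrite scale1r.
by rewrite !E !ca scale1r add0r addr0.
Qed.

Fixpoint ad_sum y c ys : N :=
  if ys is z :: t then
    c (bracket y z :: t) + ad_sum y (fun t' => c (z :: t')) t
  else 0.

Lemma ad_sumP y a c c' ys :
  ad_sum y (fun t => a *: c t + c' t) ys = a *: ad_sum y c ys + ad_sum y c' ys.
Proof.
elim: ys c c' => /= [|z ys IH] c c'; first by rewrite scaler0 addr0.
by rewrite IH scalerDr addrACA.
Qed.

Lemma ad_sum0 y ys : ad_sum y (fun=> 0) ys = 0.
Proof. by elim: ys => //= z ys ->; rewrite addr0. Qed.

Lemma ad_sumB y c c' ys :
  ad_sum y (fun t => c t - c' t) ys = ad_sum y c ys - ad_sum y c' ys.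
Proof.
have -> : (fun t => c t - c' t) = (fun t => -1 *: c' t + c t).
  by apply/funext => t; rewrite scaleN1r addrC.
by rewrite ad_sumP scaleN1r addrC.
Qed.

Lemma ad_sumD y c c' ys :
  ad_sum y (fun t => c t + c' t) ys = ad_sum y c ys + ad_sum y c' ys.
Proof.
have -> : (fun t => c t + c' t) = (fun t => 1 *: c t + c' t).
  by apply/funext => t; rewrite scale1r.
by rewrite ad_sumP scale1r.
Qed.

(** The Jacobi identity at each argument; the sign is there because substituting in the arguments
    composes contravariantly. *)
Lemma ad_sum_bracket y z c ys : alt_multilinear c ->
  ad_sum y (ad_sum z c) ys - ad_sum z (ad_sum y c) ys
    = - ad_sum (bracket y z) c ys.
Proof.
elim: ys c => /= [|x ys IH] c am; first by rewrite subrr oppr0.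
have -> : c (bracket (bracket y z) x :: ys) =
    c (bracket y (bracket z x) :: ys) - c (bracket z (bracket y x) :: ys).
  rewrite -jacobi_ad addrC -[- bracket z _]scaleN1r (am_head _ _ _ _ am).
  by rewrite scaleN1r addrC.
have := IH _ (am_cons x am); set X := ad_sum y _ ys; set Y := ad_sum z _ ys.
move=> E; rewrite !ad_sumD -/X -/Y [RHS]opprD opprB -{}E.
set A := c _; set a := ad_sum z _ _; set b := ad_sum y _ _; set B := c _.
have -> : A + a + (b + X) = (a + b) + (A + X) by rewrite [LHS](AC (2*2) ((2*3)*(1*4))).
have -> : B + b + (a + Y) = (a + b) + (B + Y) by rewrite [LHS](AC (2*2) ((3*2)*(1*4))).
by rewrite opprD addrACA subrr add0r opprD addrACA.
Qed.

(* The Chevalley-Eilenberg differential of r, by Cartan's formula             *)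
(* i_y d = L_y - d i_y; the letter y acts by (y u)(w) = u (y :: w).           *)
Fixpoint dlist r w ys : N :=
  if ys is y :: t then
    r (y :: w) t - ad_sum y (r w) t - dlist (fun w' t' => r w' (y :: t')) w t
  else 0.

Definition Lie_op y r w ys := r (y :: w) ys - ad_sum y (r w) ys.

Lemma dlistS r w y t :
  dlist r w (y :: t) = Lie_op y r w t - dlist (fun w' t' => r w' (y :: t')) w t.
Proof. by []. Qed.

Lemma eq_dlist r r' w ys : r w = r' w -> (forall y, r (y :: w) = r' (y :: w)) ->
  dlist r w ys = dlist r' w ys.
Proof.
move=> e e'; elim: ys r r' e e' => //= y t IH r r' e e'.
by rewrite e e' (IH _ (fun w t => r' w (y :: t))) // => [|z]; rewrite ?e ?e'.
Qed.

Lemma dlistP a r r' w ys :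
  dlist (fun w t => a *: r w t + r' w t) w ys = a *: dlist r w ys + dlist r' w ys.
Proof.
elim: ys r r' => /= [|y t IH] r r'; first by rewrite scaler0 addr0.
by rewrite ad_sumP IH !opprD !scalerBr (addrACA (a *: r _ _)) [LHS]addrACA.
Qed.

Lemma dlistB r r' w ys :
  dlist (fun w t => r w t - r' w t) w ys = dlist r w ys - dlist r' w ys.
Proof.
have -> : (fun w t => r w t - r' w t) = (fun w t => -1 *: r' w t + r w t).
  by apply/funext => v; apply/funext => t; rewrite scaleN1r addrC.
by rewrite dlistP scaleN1r addrC.
Qed.

Lemma dlist0 w ys : dlist (fun _ _ => 0) w ys = 0.
Proof. by elim: ys => //= y t ->; rewrite ad_sum0 !subr0. Qed.

(** If r vanishes at w, only the terms that lengthen the word survive: the Koszul differential is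
    the leading part of [dlist]. *)
Lemma dlist_koszul r w ys : (forall t, r w t = 0) -> dlist r w ys = koszul r w ys.
Proof.
elim: ys r => //= y t IH r r0; rewrite koszulS IH; last by move=> z; rewrite r0.
by have -> : r w = (fun=> 0) by [apply/funext]; rewrite ad_sum0 subr0.
Qed.

(** Cartan's relation i_z L_y = L_y i_z - i_[y,z]. *)
Lemma Lie_op_cons y z r :
  (fun w t => Lie_op y r w (z :: t)) =
  (fun w t => Lie_op y (fun w t => r w (z :: t)) w t - r w (bracket y z :: t)).
Proof.
apply/funext => w; apply/funext => t; rewrite /Lie_op /= opprD addrA.
by rewrite addrAC.
Qed.

Lemma Lie_op_bracket y z r w ys : alt_multilinear (r w) ->
  (forall t, r (z :: y :: w) t - r (y :: z :: w) t = r (bracket y z :: w) t) ->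
  Lie_op y (Lie_op z r) w ys - Lie_op z (Lie_op y r) w ys
    = Lie_op (bracket y z) r w ys.
Proof.
move=> am rel; rewrite /Lie_op.
rewrite -[ad_sum (bracket y z) _ _]opprK -ad_sum_bracket // opprB -rel.
rewrite !ad_sumB !opprB.
rewrite [LHS](AC ((2*2)*(2*2)) ((1*8)*(3*6)*((5*2)*(7*4)))).
by rewrite /= !subrr !addr0.
Qed.

(** As cons is right multiplication, [z :: y :: w] is the product w y z, and this is w y z - w z y =
    w [y, z]. *)
Definition word_rel r w := forall y z t,
  r (z :: y :: w) t - r (y :: z :: w) t = r (bracket y z :: w) t.

(** Contracting with the first argument z and using Cartan's relations on both sides reduces the
    claim to [L_y, L_z] = L_[y,z] and to r contracted with z. *)
Lemma Lie_op_dlist y r w ys : alt_multilinear (r w) -> word_rel r w ->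
  Lie_op y (dlist r) w ys = dlist (Lie_op y r) w ys.
Proof.
elim: ys r => [|z t IH] r am rel; first by rewrite /Lie_op /= subrr.
rewrite [RHS]dlistS Lie_op_cons dlistB -IH; last by move=> *; apply: rel.
  set r' := fun w t => r w (z :: t).
  have -> : Lie_op y (dlist r) w (z :: t) =
      Lie_op z r (y :: w) t - dlist r' (y :: w) t -
      (Lie_op (bracket y z) r w t - dlist (fun w t => r w (bracket y z :: t)) w t
        + (ad_sum y (Lie_op z r w) t - ad_sum y (dlist r' w) t)).
    by rewrite -ad_sumB.
  have LopE x s : Lie_op y s w x = s (y :: w) x - ad_sum y (s w) x by [].
  rewrite -Lie_op_bracket // !(LopE t) -/r'.
  move: (Lie_op z r (y :: w) t) (dlist r' (y :: w) t) (ad_sum y (Lie_op z r w) t)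
    (ad_sum y (dlist r' w) t) (Lie_op z (Lie_op y r) w t) (dlist _ w t).
  move=> a b c d e f.
  rewrite !opprD !opprK.
  rewrite [LHS](AC (2*((((2*1)*1)*2))) ((5*((2*8)*6)) * ((1*3)*(4*7)))) /=.
  by rewrite !subrr !addr0.
exact: am_cons.
Qed.

(** With i_y d = L_y - d i_y and L_y d = d L_y one gets i_y d d = d d i_y, which has one argument
    fewer. *)
Lemma dlist_dlist r w ys : alt_multilinear (r w) -> word_rel r w ->
  dlist (dlist r) w ys = 0.
Proof.
elim: ys r => //= y t IH r am rel.
rewrite -[X in X - _]/(Lie_op y (dlist r) w t) Lie_op_dlist //.
rewrite (_ : (fun w t => dlist r w (y :: t)) =
  fun w t => Lie_op y r w t - dlist (fun w t => r w (y :: t)) w t) //.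
rewrite dlistB IH ?subr0 ?subrr //; exact: am_cons.
Qed.

Lemma am_ad_sum c y : alt_multilinear c -> alt_multilinear (ad_sum y c).
Proof.
move=> am; split=> [p q a u v|p q u].
  elim: p c am => [|z p IH] c am /=.
    rewrite bracketPr (am_head _ _ _ _ am).
    rewrite (_ : (fun t => c (a *: u + v :: t)) = fun t => a *: c (u :: t) + c (v :: t)).
      by rewrite ad_sumP scalerDr addrACA.
    by apply/funext => t; exact: am_head.
  rewrite (IH _ (am_cons z am)) (am_lin (am_cons (bracket y z) am)).
  by rewrite scalerDr addrACA.
elim: p c am => [|z p IH] c am /=; last first.
  by rewrite (IH _ (am_cons z am)) (am_alt (am_cons (bracket y z) am)) addr0.
have := @am_swap c [::] q (bracket y u) u am; rewrite /= => ->.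
rewrite addKr -(ad_sum0 y q); congr ad_sum; apply/funext => t.
exact: (am_alt am [::]).
Qed.

Lemma am_dlist r w : (forall w, alt_multilinear (r w)) ->
    (forall a u v t, r (a *: u + v :: w) t = a *: r (u :: w) t + r (v :: w) t) ->
  alt_multilinear (dlist r w).
Proof.
move=> am lin; split=> [p q a u v|p q u].
  elim: p r am lin => [|y p IH] r am lin.
    rewrite !dlistS /Lie_op lin.
    rewrite (_ : (fun w t => r w (a *: u + v :: t)) =
        fun w t => a *: r w (u :: t) + r w (v :: t)); last first.
      by apply/funext => x; apply/funext => t; exact: am_head.
    rewrite dlistP.
    have -> : ad_sum (a *: u + v) (r w) q = a *: ad_sum u (r w) q + ad_sum v (r w) q.
      have := am w; elim: q (r w) => [|z q IH] c cm /=; first by rewrite scaler0 addr0.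
      rewrite bracketPl (am_head _ _ _ _ cm) (IH _ (am_cons z cm)).
      by rewrite scalerDr addrACA.
    by rewrite !opprD !scalerBr (addrACA (a *: r _ _)) [LHS]addrACA.
  rewrite !cat_cons !dlistS (IH (fun w t => r w (y :: t))) // => [|w'].
  - rewrite /Lie_op (am_lin (am _)) (am_lin (am_ad_sum y (am w))).
    by rewrite !opprD !scalerBr (addrACA (a *: r _ _)) [LHS]addrACA.
  - exact: am_cons.
elim: p r am {lin} => [|y p IH] r am.
  rewrite !dlistS; set X := dlist _ _ _; have -> : X = 0.
    rewrite /X -(dlist0 w q); apply: eq_dlist => [|y];
      by apply/funext => t; exact: (am_alt (am _) [::]).
  by rewrite subr0 /Lie_op /= bracketxx (am0 [::] _ (am w)) add0r subrr.
rewrite cat_cons dlistS (IH (fun w t => r w (y :: t))) => [|w']; last exact: am_cons.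
rewrite /Lie_op (am_alt (am _)) (am_alt (am_ad_sum y (am w))).
by rewrite !subr0.
Qed.

End ListCochains.

(** * Linear maps on words *)

Section ActTheory.
Variables (K : fieldType) (g : lieAlgType K) (M : lieModType g).

Lemma act0 (x : g) : act x (0 : M) = 0.
Proof. by have := actPr (-1) x (0 : M) 0; rewrite scaleN1r addNr scaleN1r addNr. Qed.

Lemma actZ (x : g) a (m : M) : act x (a *: m) = a *: act x m.
Proof. by rewrite -[a *: m]addr0 actPr act0 addr0. Qed.

End ActTheory.

Section AltModule.
Variables (K : fieldType) (g h : lieAlgType K) (N : lieModType g).

Definition altmod_pred : {pred seq h -> N} :=
  [pred c | `[< alt_multilinear c >]].

Fact altmod_submod : submod_closed altmod_pred.
Proof.
split; first by apply/asboolP; split=> *; rewrite ?scaler0 ?addr0.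
by move=> a c c' /asboolP am /asboolP am'; apply/asboolP/amP.
Qed.

HB.instance Definition _ :=
  GRing.isSubmodClosed.Build K (seq h -> N) altmod_pred altmod_submod.

(** Here g acts on the values only. A U(g)-linear map from U(h) tensored with the exterior algebra
    of h to N thus becomes a U(g)-linear map from U(h) to [altmod h N], and results on [wordfun] for
    arbitrary modules apply to cochains. *)
Definition altmod : Type := {c : seq h -> N | c \in altmod_pred}.
HB.instance Definition _ := SubChoice.on altmod.
HB.instance Definition _ := [SubChoice_isSubLmodule of altmod by <:].

Lemma altmodP (c : altmod) : alt_multilinear (\val c).
Proof. exact/asboolP/(valP c). Qed.

Definition Altmod c (am : alt_multilinear c) : altmod := Sub c (asboolT am).

Fact altmod_act_subproof (x : g) (c : altmod) :
  alt_multilinear (fun t => act x (\val c t)).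
Proof.
have [cl ca] := altmodP c.
by split=> *; rewrite ?cl ?ca ?act0 ?actPr.
Qed.

Definition altmod_act (x : g) (c : altmod) : altmod :=
  Altmod (altmod_act_subproof x c).

Fact altmod_actPl (a : K) (x y : g) (m : altmod) :
  altmod_act (a *: x + y) m = a *: altmod_act x m + altmod_act y m.
Proof. by apply/val_inj/funext => t /=; rewrite actPl. Qed.

Fact altmod_actPr (a : K) (x : g) (m p : altmod) :
  altmod_act x (a *: m + p) = a *: altmod_act x m + altmod_act x p.
Proof. by apply/val_inj/funext => t; exact: actPr. Qed.

Fact altmod_act_bracket (x y : g) (m : altmod) : altmod_act (bracket x y) m =
  altmod_act x (altmod_act y m) - altmod_act y (altmod_act x m).
Proof. by apply/val_inj/funext => t /=; rewrite act_bracket. Qed.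

HB.instance Definition _ := @Lmodule_isLieModule.Build K g altmod
  altmod_act altmod_actPl altmod_actPr altmod_act_bracket.

End AltModule.

Section Words.
Variables (K : fieldType) (g h : lieAlgType K) (phi : lieHom g h).

(* The word [:: y_k; ..; y_1] stands for the product y_1 .. y_k in U(h), so   *)
(* that right multiplication by y is cons, and wordfun k u means that u is a  *)
(* U(g)-linear map to N on the words of length at most k; its other values    *)
(* are irrelevant.                                                            *)
Record wordfun (N : lieModType g) k (u : seq h -> N) : Prop := {
  wf_lin : forall p q a x y, (size (p ++ x :: q) <= k)%N ->
    u (p ++ a *: x + y :: q) = a *: u (p ++ x :: q) + u (p ++ y :: q);
  wf_rel : forall p q y z, (size (p ++ y :: z :: q) <= k)%N ->
    u (p ++ z :: y :: q) - u (p ++ y :: z :: q) = u (p ++ bracket y z :: q);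
  wf_act : forall p x, (size p < k)%N -> u (rcons p (phi x)) = act x (u p)
}.

Section Basic.
Variables (N : lieModType g).
Implicit Types (u : seq h -> N) (r : seq h -> seq h -> N).

Lemma sub_wordfun k l u : (k <= l)%N -> wordfun l u -> wordfun k u.
Proof.
by move=> kl [ul ur ua]; split=> *; rewrite ?ul ?ur ?ua //; exact: leq_trans kl.
Qed.

Lemma wordfun_cons k u y : wordfun k.+1 u -> wordfun k (fun w => u (y :: w)).
Proof.
move=> [ul ur ua]; split=> [p q a x z sz|p q x z sz|p x sz].
- exact: (ul (y :: p)).
- exact: (ur (y :: p)).
- exact: (ua (y :: p)).
Qed.

Lemma wordfunP k a u u' : wordfun k u -> wordfun k u' ->
  wordfun k (fun w => a *: u w + u' w).
Proof.
move=> [ul ur ua] [ul' ur' ua']; split=> [p q b x z sz|p q x z sz|p x sz].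
- by rewrite ul // ul' // !scalerDr !scalerA mulrC addrACA.
- by rewrite -ur // -ur' // opprD addrACA scalerBr.
- by rewrite ua // ua' // actPr.
Qed.

Lemma wordfun0 k : wordfun k (fun=> 0 : N).
Proof. by split=> *; rewrite ?scaler0 ?subr0 ?addr0 ?act0. Qed.

Lemma wordfunD k u u' : wordfun k u -> wordfun k u' ->
  wordfun k (fun w => u w + u' w).
Proof.
move=> wu wu'; have := wordfunP 1 wu wu'.
by under eq_fun do rewrite scale1r.
Qed.

Lemma wordfunB k u u' : wordfun k u -> wordfun k u' ->
  wordfun k (fun w => u w - u' w).
Proof.
move=> wu wu'; have := wordfunP (-1) wu' wu.
by under eq_fun do rewrite scaleN1r addrC.
Qed.

(** The differential lengthens words by right multiplication, which commutes with the left action of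
    U(g); this uses up one letter. *)
Lemma wordfun_dlist k r : (forall ys, wordfun k.+1 (r^~ ys)) ->
  forall ys, wordfun k ((dlist r)^~ ys).
Proof.
move=> wr ys; elim: ys r wr => [|y t IH] r wr; first exact: wordfun0.
apply: wordfunB; last by apply: (IH (fun w t => r w (y :: t))) => ys; exact: wr.
apply: wordfunB; first exact: (wordfun_cons y (wr t)).
apply: (sub_wordfun (leqnSn k)); move: wr; elim: t r {IH} => [|z t IH] r wr /=.
  exact: wordfun0.
apply: wordfunD; first exact: wr.
by apply: (IH (fun w t => r w (z :: t))) => ys; exact: wr.
Qed.
End Basic.

Lemma wordfun_val (N : lieModType g) k (r : seq h -> altmod h N) ys :
  wordfun k r -> wordfun k (fun w => \val (r w) ys).
Proof.
move=> [rl rr ra]; split=> [p q a x z sz|p q x z sz|p x sz].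
- by rewrite rl.
- by rewrite -rr.
- by rewrite ra.
Qed.

Lemma wordfun_altmod (N : lieModType g) k (r : seq h -> altmod h N) :
  (forall ys, wordfun k (fun w => \val (r w) ys)) -> wordfun k r.
Proof.
move=> wr; split=> [p q a x z sz|p q x z sz|p x sz];
  apply/val_inj/funext => ys; have [rl rr ra] := wr ys.
- exact: rl.
- exact: rr.
- exact: ra.
Qed.

(** The defect of r on words of length k is a Koszul cocycle; subtracting a primitive of it,
    supported on words of length k + 1, removes the defect. The hypothesis for k = 0 supplies the
    vanishing on arguments from g that [koszul_exact] asks for. *)
Lemma cocycle_correction (N : lieModType g) k (r : seq h -> altmod h N) :
    wordfun k.+1 r ->
    (forall w ys, (size w < k)%N -> dlist (fun w => \val (r w)) w ys = 0) ->
    (k = 0 -> forall xs, dlist (fun w => \val (r w)) [::] (map phi xs) = 0) ->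
  exists r' : seq h -> altmod h N, [/\ wordfun k.+1 r',
    forall w, (size w <= k)%N -> r' w = r w &
    forall w ys, (size w <= k)%N -> dlist (fun w => \val (r' w)) w ys = 0].
Proof.
move=> wr dr0 drphi; set R := fun w => \val (r w).
have wR ys : wordfun k.+1 (R^~ ys) by exact: wordfun_val.
have wdR := wordfun_dlist wR.
have amR w : alt_multilinear (R w) by exact: altmodP.
pose e w ys := if size w == k then dlist R w ys else 0.
have e_am w : alt_multilinear (e w).
  rewrite /e; case: eqP => [sw|_]; last by split=> *; rewrite ?scaler0 ?addr0.
  apply: am_dlist => // a u v t; apply: (wf_lin (wR t) (p := [::])).
  by rewrite /= sw.
(* Exchanging neighbours changes the value by that on a word of length k - 1, where the differential
   is 0. The same exchange carries a letter from g to the end of the list, where it acts on N. *)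
have e_sym p q u v ys : e (p ++ u :: v :: q) ys = e (p ++ v :: u :: q) ys.
  rewrite /e !size_cat /=; case: eqP => // sz.
  apply/eqP; rewrite -subr_eq0 (wf_rel (wdR ys)) ?size_cat /= ?sz //.
  by rewrite dr0 // size_cat /= -sz !addnS.
have sae : sym_alt phi predT e.
  split=> [p q a u v ys _|p q u v ys _|p q x ys _|w p q a u v _|w p q u _].
  - rewrite /e !size_cat /=; case: eqP => sz; last by rewrite scaler0 addr0.
    by apply: (wf_lin (wdR ys)); rewrite size_cat /= sz.
  - exact: e_sym.
  - elim: q p => [|z q IH] p; last by rewrite e_sym -cat_rcons IH.
    rewrite cats1 /e size_rcons; case: eqP => // sz.
    by rewrite (wf_act (wdR ys)) ?sz // dr0 ?act0 // -sz.
  - exact: (am_lin (e_am w)).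
  - exact: (am_alt (e_am w)).
(* At a word of length k - 1, [dlist R] vanishes, so its differential there is its Koszul
   differential. *)
have ke w ys : koszul e w ys = 0.
  have [sw|sw] := eqVneq (size w).+1 k; last first.
    rewrite -(asum0 _ ys) /koszul; congr asum; apply/funext => y.
    by apply/funext => t; rewrite /e /= (negPf sw).
  rewrite -(@dlist_dlist _ _ _ R w ys) //; last first.
    by move=> y z t; apply: (wf_rel (wR t) (p := [::])); rewrite /= sw.
  rewrite dlist_koszul => [|t]; last by rewrite dr0 // -sw.
  congr asum; apply/funext => y; apply/funext => t.
  by rewrite /e /= sw eqxx.
have e0 ys : all [pred y | `[< exists x, y = phi x >]] ys -> e [::] ys = 0.
  move=> ysphi; rewrite /e; case: eqP => // /= /esym k0.
  suff [xs ->] : exists xs, ys = map phi xs by exact: drphi.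
  elim: ys ysphi => [|y ys IH] /=; first by exists [::].
  by move=> /andP[/asboolP[x ->] /IH[xs ->]]; exists (x :: xs).
have [s sas ks] := koszul_exact sae ke e0.
have T l : all (@predT h) l by exact: all_predT.
have ams w : alt_multilinear (s w).
  split=> [p q a u v|p q u]; first exact: (sa_altlin sas _ (T _)).
  exact: (sa_alt sas (T _)).
(* Brackets land in shorter words, where [S] is 0, so symmetry of s is exactly the bracket relation
   in length k + 1. *)
pose S w := if size w == k.+1 then Altmod (ams w) else 0.
have SE w ys : size w = k.+1 -> \val (S w) ys = s w ys by rewrite /S => ->; rewrite eqxx.
have S0 w : size w != k.+1 -> S w = 0 by rewrite /S => /negPf ->.
exists (fun w => r w - S w); split.
- apply: wordfun_altmod => ys; apply: wordfunB; first exact: wR.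
  split=> [p q a x z sz|p q x z sz|p x sz].
  + have ss x' : size (p ++ x' :: q) = size (p ++ x :: q) by rewrite !size_cat.
    have [e1|ne] := eqVneq (size (p ++ x :: q)) k.+1; last first.
      by rewrite !S0 ?ss //= scaler0 addr0.
    by rewrite !SE ?ss // (sa_lin sas) // T.
  + rewrite [S (_ ++ bracket _ _ :: _)]S0; last first.
      by move: sz; rewrite !size_cat /= !addnS => sz; rewrite neq_ltn sz.
    have ss : size (p ++ z :: x :: q) = size (p ++ x :: z :: q) by rewrite !size_cat.
    have [e1|ne] := eqVneq (size (p ++ x :: z :: q)) k.+1; last first.
      by rewrite !S0 ?ss //= subrr.
    by rewrite !SE ?ss // (sa_sym sas) ?subrr // T.
  + rewrite [S p]S0 ?act0; last by rewrite neq_ltn sz.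
    have [e1|ne] := eqVneq (size (rcons p (phi x))) k.+1; last by rewrite S0.
    by rewrite SE // -cats1 (sa_ker sas) // T.
- by move=> w sw; rewrite S0 ?subr0 // neq_ltn ltnS sw.
- move=> w ys sw.
  have -> : dlist (fun w => \val (r w - S w)) w ys =
     dlist R w ys - dlist (fun w => \val (S w)) w ys by rewrite -dlistB.
  rewrite [X in _ - X]dlist_koszul => [|t]; last by rewrite S0 // neq_ltn ltnS sw.
  have [e1|ne] := eqVneq (size w) k.
    rewrite [X in _ - X](_ : _ = dlist R w ys) ?subrr //.
    have <- : e w ys = dlist R w ys by rewrite /e e1 eqxx.
    rewrite -ks; congr asum; apply/funext => y; apply/funext => t.
    by rewrite SE //= e1.
  rewrite dr0 ?sub0r; last by rewrite ltn_neqAle ne.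
  apply/eqP; rewrite oppr_eq0; apply/eqP; rewrite -(asum0 _ ys); congr asum.
  by apply/funext => y; apply/funext => t; rewrite S0.
Qed.

End Words.

(** * The Chevalley-Eilenberg differential on lists *)

Section ListCE.
Variables (K : fieldType) (g : lieAlgType K) (M : lieModType g).

(* Only the words of length at most 1 matter in [dce].                        *)
Definition word_act (c : seq g -> M) (w t : seq g) : M :=
  if w is x :: _ then act x (c t) else c t.

Definition dce c := dlist (word_act c) [::].

Lemma dceS c x t :
  dce c (x :: t) = act x (c t) - ad_sum x c t - dce (fun t => c (x :: t)) t.
Proof. by []. Qed.

Lemma eq_ad_sum (N : lmodType K) n y (c c' : seq g -> N) t :
  (forall t, size t = n -> c t = c' t) -> size t = n ->
  ad_sum y c t = ad_sum y c' t.
Proof.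
elim: t n c c' => [|z t IH] [|n] c c' cc' //= [sz].
rewrite cc' /= ?sz // (IH n _ (fun t => c' (z :: t))) // => t' st'.
by rewrite cc' //= st'.
Qed.

Lemma eq_dlist_size (N : lmodType K) n (r r' : seq g -> seq g -> N) w ys :
  (forall t, size t = n -> r w t = r' w t) ->
  (forall y t, size t = n -> r (y :: w) t = r' (y :: w) t) ->
  size ys = n.+1 -> dlist r w ys = dlist r' w ys.
Proof.
elim: ys n r r' => //= y ys IH n r r' e e' [sz].
rewrite e' // (eq_ad_sum y e sz); congr (_ - _).
case: n ys IH sz e e' => [|n] ys IH sz e e'; first by case: ys sz {IH}.
by apply: (IH n) => [t st|z t st|//]; rewrite ?e ?e' //= st.
Qed.

Lemma dce_size n (c : seq g -> M) ys :
  (forall t, size t = n -> c t = 0) -> size ys = n.+1 -> dce c ys = 0.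
Proof.
move=> c0 sz; rewrite -(dlist0 M [::] ys).
by apply: (eq_dlist_size (n := n)) sz => [t|y t] /c0 //= ->; rewrite act0.
Qed.
End ListCE.

(** * Extension from g to h along word length *)

Section Extension.
Variables (K : fieldType) (g h : lieAlgType K) (phi : lieHom g h).

Lemma ad_sum_map (N : lmodType K) x (c : seq h -> N) xs :
  ad_sum (phi x) c (map phi xs) = ad_sum x (c \o map phi) xs.
Proof.
elim: xs c => //= z xs IH c; rewrite lie_morphB; congr (_ + _).
by rewrite (IH (fun t => c (phi z :: t))).
Qed.

(** On arguments from g the letter phi x acts as x does on N, so the differential at the empty word
    is that of g. *)
Lemma dlist_map (N : lieModType g) (r : seq h -> seq h -> N) xs :
  (forall x t, r [:: phi x] t = act x (r [::] t)) ->
  dlist r [::] (map phi xs) = dce (r [::] \o map phi) xs.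
Proof.
elim: xs r => //= x xs IH r rphi; rewrite rphi ad_sum_map dceS.
by rewrite (IH (fun w t => r w (phi x :: t))).
Qed.

Hypothesis phi_inj : injective phi.

Lemma eq_wordfun (N : lieModType g) k (u u' : seq h -> N) :
  (forall w, (size w <= k)%N -> u w = u' w) ->
  wordfun phi k u -> wordfun phi k u'.
Proof.
move=> uu' [ul ur ua]; split=> [p q a x z sz|p q x z sz|p x sz].
- by rewrite -!uu' ?ul //; move: sz; rewrite !size_cat.
- by rewrite -!uu' ?ur //; move: sz; rewrite !size_cat //= !addnS => /ltnW.
- by rewrite -!uu' ?ua ?size_rcons // ltnW.
Qed.

(** A map u on nonempty words is the same as a 1-cochain r with r w [:: y] = u (y :: w), and the
    relation for the first two letters is its closedness. The induction is over all modules at once: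
    r is extended as a map to [altmod h N], then corrected to be closed. *)
Lemma wordfun_extend k (N : lieModType g) (u : seq h -> N) :
  wordfun phi k u -> exists u', wordfun phi k.+1 u' /\
    forall w, (size w <= k)%N -> u' w = u w.
Proof.
elim: k N u => [|k IH] N u wu.
  have [pi pil piK] := linear_retraction (phi := phi) phi_inj.
  exists (fun w => if w is y :: _ then act (pi y) (u [::]) else u [::]).
  split; last by case.
  split=> [p q a x y|p q y z|p x].
  - rewrite size_cat addnS ltnS leqn0 addn_eq0 => /andP[/nilP -> /nilP ->] /=.
    by rewrite pil actPl.
  - by rewrite size_cat !addnS.
  - by rewrite ltnS leqn0 => /nilP -> /=; rewrite piK.
(* Cut off to 0 where [y :: w] exceeds the length on which u is controlled. *)
pose c w ys := if (size ys == 1) && (size w <= k)%N then u (head 0 ys :: w) else 0.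
have amc w : alt_multilinear (c w).
  rewrite /c; split=> [[|z [|z' p]] [|y q] a x x'|[|z [|z' p]] q x] /=;
    rewrite ?scaler0 ?addr0 //.
  case: leqP => sw; last by rewrite scaler0 addr0.
  by apply: (wf_lin wu (p := [::])).
pose r w := Altmod (amc w).
have rE w y : (size w <= k)%N -> \val (r w) [:: y] = u (y :: w).
  by rewrite /= /c /= => ->.
have r0 w t : size t != 1 -> \val (r w) t = 0.
  by rewrite /= /c => /negPf ->.
have wr : wordfun phi k r.
  apply: wordfun_altmod => ys; have [|s1] := eqVneq (size ys) 1; last first.
    by apply: eq_wordfun (wordfun0 _ _ k) => w _; rewrite r0.
  case: ys => [|y [|//]] //= _.
  apply: eq_wordfun (wordfun_cons y wu) => w sw.
  by rewrite -[RHS]/(\val (r w) [:: y]) rE.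
have [r1 [wr1 r1E]] := IH _ _ wr.
(* On shorter words closedness is the bracket relation for u; at the empty word, on arguments from
   g, it is the bracket axiom of the module N. *)
have [w ys sw|k0 xs|r2 [wr2 r2E dr2]] := cocycle_correction wr1.
- have sw' := ltnW sw.
  have [|s2] := eqVneq (size ys) 2.
    case: ys => [|z [|y [|//]]] //= _.
    rewrite !r1E // !rE //= !subr0 addr0.
    have := wf_rel wu (p := [::]) (q := w) (y := z) (z := y) sw => /= <-.
    by rewrite opprB addrCA subrr addr0 subrr.
  case: ys s2 => // z ys s2; rewrite -(dlist0 N w (z :: ys)).
  by apply: (eq_dlist_size (n := size ys)) => [t st|y t st|//]; rewrite r1E // r0 // st.
- have r10 := r1E [::] isT.
  rewrite dlist_map => [|x t]; last by rewrite (wf_act wr1 (p := [::])).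
  rewrite r10; have [|s2] := eqVneq (size xs) 2; last first.
    case: xs s2 => // x xs s2; apply: (@dce_size _ _ _ (size xs)) => // t st.
    by rewrite /= -[LHS]/(\val (r [::]) (map phi t)) r0 // size_map st.
  case: xs => [|z [|y [|//]]] //= _.
  rewrite !dceS /= /c /= !subr0 addr0.
  have uphi x : u [:: phi x] = act x (u [::]) by exact: (wf_act wu (p := [::])).
  rewrite !uphi act_bracket. by rewrite opprB addrCA subrr addr0 subrr.
- have am2 w := altmodP (r2 w).
  exists (fun w => if w is y :: w' then \val (r2 w') [:: y] else u [::]); split.
    have wr2' y := wordfun_val [:: y] wr2.
    split=> [[|z p] q a x y sz|[|x p] q y z sz|[|z p] x sz] /=.
    + exact: (am_lin (am2 q) [::]).
    + exact: (wf_lin (wr2' z)).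
    (* The relation for the first two letters is closedness of [r2] at y, z. *)
    + have /= := dr2 q [:: y; z] sz; rewrite !subr0 addr0 => /eqP.
      by rewrite subr_eq0 subr_eq -subr_eq => /eqP <-; rewrite opprB addrC subrK.
    + exact: (wf_rel (wr2' x)).
    + by rewrite r2E // r1E // rE // (wf_act wu (p := [::])).
    + exact: (wf_act (wr2' z)).
  by case=> // y w sw; rewrite r2E // r1E // rE.
Qed.

Lemma cocycle_extend (N : lieModType g) (c : seq g -> N) :
    alt_multilinear c -> (forall xs, dce c xs = 0) ->
  exists r : seq h -> altmod h N, [/\ forall k, wordfun phi k r,
    forall w ys, dlist (fun w => \val (r w)) w ys = 0 &
    forall xs, \val (r [::]) (map phi xs) = c xs].
Proof.
move=> amc dc0.
pose P k (r : seq h -> altmod h N) := [/\ wordfun phi k r,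
  forall w ys, (size w < k)%N -> dlist (fun w => \val (r w)) w ys = 0 &
  forall xs, \val (r [::]) (map phi xs) = c xs].
have P0 : exists r, P 0 r.
  have [pi pil piK] := linear_retraction (phi := phi) phi_inj.
  have amp : alt_multilinear (c \o map pi).
    split=> [p q a x y|p q x] /=; rewrite !map_cat /=.
      by rewrite pil (am_lin amc).
    exact: (am_alt amc).
  (* In length 0 the conditions on words are vacuous, and c is extended to arguments in h along the
     retraction [pi]. *)
  exists (fun=> Altmod amp); split=> [|//|xs].
    by split=> // -[].
  by rewrite /= mapK.
have Pstep k r : P k r -> exists r', P k.+1 r' /\
    forall w, (size w <= k)%N -> r' w = r w.
  move=> [wr dr rc]; have [r1 [wr1 r1E]] := wordfun_extend wr.
  have [w ys sw|k0 xs|r2 [wr2 r2E dr2]] := cocycle_correction wr1.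
  - rewrite -(dr w ys) //; apply: eq_dlist => [|y]; rewrite r1E //.
    exact: ltnW.
  - rewrite dlist_map => [|x t]; last by rewrite (wf_act wr1 (p := [::])).
    rewrite -(dc0 xs); congr (dce _ xs); apply/funext => t /=.
    by rewrite r1E // rc.
  - exists r2; split=> [|w sw]; last by rewrite r2E // r1E.
    by split=> // xs; rewrite r2E // r1E // rc.
have [r0 Pr0] := cid P0.
pose step k (r : {r | P k r}) : {r | P k.+1 r} :=
  let e := cid (Pstep k _ (svalP r)) in exist _ (sval e) (proj1 (svalP e)).
have stepE k r w : (size w <= k)%N -> sval (step k r) w = sval r w.
  by move=> sw; rewrite /step /=; case: cid => r' /= [_ ->].
pose f := fix f k : {r | P k r} :=
  if k is k'.+1 then step k' (f k') else exist _ r0 Pr0.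
have fE k w : (size w <= k)%N -> sval (f k) w = sval (f (size w)) w.
  elim: k => [|k IH]; first by rewrite leqn0 => /eqP ->.
  by rewrite leq_eqVlt => /orP[/eqP -> //|sw]; rewrite stepE // IH.
(* Later stages leave the value at w unchanged, so the stages have a limit. *)
exists (fun w => sval (f (size w)) w); split=> [k|w ys|xs].
- have [wr _ _] := svalP (f k); apply: eq_wordfun wr => w sw; exact: fE.
(* At w the differential also reads the words [y :: w], hence the stage one further. *)
- have [_ dr _] := svalP (f (size w).+1); rewrite -(dr w ys) //.
  by apply: eq_dlist => [|y]; rewrite [in RHS]fE.
- by have [_ _ rc] := svalP (f 0); exact: rc.
Qed.

End Extension.

(** * The coinduced module *)

Section ToList.
Variable T : Type.

Definition tolist n (x : 'I_n -> T) : seq T := map x (enum 'I_n).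

Lemma size_tolist n (x : 'I_n -> T) : size (tolist x) = n.
Proof. by rewrite size_map size_enum_ord. Qed.

Lemma tolistS n (x : 'I_n.+1 -> T) :
  tolist x = x ord0 :: tolist (x \o lift ord0).
Proof. by rewrite /tolist enum_ordSl /= -map_comp. Qed.

Lemma tolist_fcons n a (y : 'I_n -> T) :
  tolist (fcons (n := n.+1) a y) = a :: tolist y.
Proof.
rewrite tolistS /= unlift_none; congr (_ :: _).
by apply: eq_map => i /=; rewrite liftK.
Qed.

Lemma nth_tolist n (x : 'I_n -> T) x0 (i : 'I_n) : nth x0 (tolist x) i = x i.
Proof. by rewrite (nth_map i) ?size_enum_ord // nth_ord_enum. Qed.

Lemma tolist_lift0 n (x : 'I_n.+2 -> T) (i : 'I_n.+1) :
  tolist (x \o lift (lift ord0 i)) = x ord0 :: tolist (x \o lift ord0 \o lift i).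
Proof.
rewrite tolistS /=; congr (x _ :: _); first exact: val_inj.
by apply: eq_map => k /=; congr x; apply: val_inj; rewrite /= /bump /= !add1n addnS.
Qed.

End ToList.

(** * Comparison of cochains on tuples and on lists *)

Section CEList.
Variables (K : fieldType) (g : lieAlgType K).

(** Moving the bracket from place j to the front costs (-1)^j. *)
Lemma ad_sum_tolist (N : lmodType K) y (c : seq g -> N) n (x : 'I_n.+1 -> g) :
  alt_multilinear c -> ad_sum y c (tolist x) =
    \sum_(j < n.+1) (-1) ^+ j *: c (bracket y (x j) :: tolist (x \o lift j)).
Proof.
elim: n c x => [|n IH] c x am.
  rewrite big_ord1 expr0 scale1r tolistS /= /tolist.
  by rewrite (size0nil (size_enum_ord 0)) addr0.
rewrite big_ord_recl expr0 scale1r tolistS /=; congr (_ + _).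
rewrite (IH _ _ (am_cons _ am)); apply: eq_bigr => j _.
rewrite tolist_lift0 exprS mulN1r scaleNr -scalerN; congr (_ *: _).
by rewrite (am_swap [::] _ _ _ am).
Qed.

(** Cartan's formula for contraction with x_0: the action of x_0 and the brackets [x_0, x_j] form
    the Lie derivative, and the remaining terms are minus the differential of the contracted
    cochain. *)
Lemma ce_diff_tolist (M : lieModType g) n (c : seq g -> M) (x : 'I_n.+1 -> g) :
  alt_multilinear c ->
  ce_diff (fun t : 'I_n -> g => c (tolist t)) x = dce c (tolist x).
Proof.
have nil0 (t : 'I_0 -> g) : tolist t = [::] by apply: size0nil; rewrite size_tolist.
elim: n c x => [|n IH] c x am.
  rewrite /ce_diff !big_ord1 big_ord0 addr0 expr0 scale1r tolistS !nil0.
  by rewrite /dce /= !subr0.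
rewrite tolistS dceS -(IH _ _ (am_cons _ am)) ad_sum_tolist //.
rewrite /ce_diff big_ord_recl expr0 scale1r -!addrA; congr (_ + _).
rewrite opprD addrCA -!sumrN; congr (_ + _).
  by apply: eq_bigr => i _; rewrite tolist_lift0 lift0 exprS mulN1r scaleNr.
rewrite big_ord_recl big_pred0 // add0r -big_split /=; apply: eq_bigr => j _.
rewrite big_mkcond big_ord_recl /=; congr (_ + _).
  rewrite tolist_fcons add0n /bump leq0n add1n exprS mulN1r scaleNr; congr (- _).
  congr (_ *: c (bracket (x _) _ :: _)); first exact: val_inj.
  apply: eq_map => k /=; congr x; apply: val_inj.
  by rewrite /= /bump /= !add1n ltnS addnS.
(* Brackets without x_0: the bracket has to pass x_0, which accounts for the sign. *)
rewrite -sumrN [RHS]big_mkcond; apply: eq_bigr => i _.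
rewrite /bump leq0n !add1n ltnS; case: ifP => // _.
rewrite addnS addSn !exprS !mulN1r opprK -scalerN; congr (_ *: _).
case: n i j {IH} x => [[]//|n] i j x.
rewrite !tolist_fcons tolistS (am_swap [::] _ _ _ am) /=.
have bumpSS (a b : nat) : bump a.+1 b.+1 = (bump a b).+1 by rewrite /bump ltnS addnS.
congr (- c [:: x _, bracket (x _) _ & _]).
- exact: val_inj.
- by apply: val_inj; rewrite /= /bump leq0n !add1n ltnS addnS.
- apply: eq_map => k /=; congr x; apply: val_inj.
  by rewrite /= ![bump 0 _]add1n !bumpSS.
Qed.

Lemma am_far (N : lmodType K) (c : seq g -> N) p u m q :
  alt_multilinear c -> c (p ++ u :: m ++ u :: q) = 0.
Proof.
move=> am; elim: m p => [|v m IH] p /=; first exact: (am_alt am).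
by rewrite (am_swap p _ _ _ am) -cat_rcons IH oppr0.
Qed.

Section CochainList.
Variables (M : lieModType g) (n : nat).

Lemma tolist_split (x : 'I_n -> g) (i : 'I_n) : exists p q,
  forall u, tolist [eta x with i |-> u] = p ++ u :: q.
Proof.
exists (take i (tolist x)), (drop i.+1 (tolist x)) => u.
have sx := size_tolist x.
apply: (@eq_from_nth _ 0) => [|k].
  rewrite size_cat /= size_take size_drop size_tolist sx ltn_ord.
  by rewrite addnS -addSn subnKC.
rewrite size_tolist => kn; rewrite (nth_tolist _ 0 (Ordinal kn)) /=.
rewrite nth_cat size_take sx ltn_ord -val_eqE /=.
case: ltngtP => [ki|ik|->]; last by rewrite subnn.
  by rewrite nth_take // (nth_tolist _ 0 (Ordinal kn)).
rewrite -[(k - i)%N]prednK ?subn_gt0 //= nth_drop.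
by rewrite -subnS subnKC // (nth_tolist _ 0 (Ordinal kn)).
Qed.

Lemma cochain_of_list (c : seq g -> M) : alt_multilinear c ->
  (fun x : 'I_n -> g => c (tolist x)) \in @cochain K g M n.
Proof.
move=> am; apply/cochainP; split=> [i x a u v|x i j].
  by have [p [q E]] := tolist_split x i; rewrite !E (am_lin am).
wlog ij : i j / (i < j)%N.
  move=> H; have [/H //|ji|/val_inj ->] := ltngtP i j; last by rewrite eqxx.
  by rewrite eq_sym => ne /esym; apply: H.
move=> _ xij; have sx := size_tolist x; have xE := nth_tolist x 0.
have dropE (k : 'I_n) : drop k (tolist x) = x k :: drop k.+1 (tolist x).
  by rewrite -xE -drop_nth // sx.
rewrite -(cat_take_drop i (tolist x)) dropE.
rewrite -(cat_take_drop (j - i.+1) (drop i.+1 _)) drop_drop subnK //.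
by rewrite dropE -xij am_far.
Qed.

(** The value 0 in all other lengths keeps the function alternating and multilinear on lists of
    every length. *)
Definition list_of_cochain (f : ('I_n -> g) -> M) (t : seq g) : M :=
  if size t == n then f (fun i => nth 0 t i) else 0.

Lemma list_of_cochainK f x : list_of_cochain f (tolist x) = f x.
Proof.
rewrite /list_of_cochain size_tolist eqxx; congr f; apply/funext => i.
exact: nth_tolist.
Qed.

Lemma am_list_of_cochain f : f \in @cochain K g M n ->
  alt_multilinear (list_of_cochain f).
Proof.
move=> /cochainP[mf af].
have upd (p q : seq g) (sz : size (p ++ 0 :: q) = n) (ip : (size p < n)%N) z :
    (fun i : 'I_n => nth 0 (p ++ z :: q) i)
      = [eta (fun i : 'I_n => nth 0 (p ++ 0 :: q) i) with Ordinal ip |-> z].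
  apply/funext => k /=; rewrite -val_eqE /= !nth_cat.
  case: ltngtP => [//|kp|->]; last by rewrite subnn.
  by rewrite -[(k - size p)%N]prednK ?subn_gt0.
rewrite /list_of_cochain; split=> [p q a u v|p q u].
  have ss z : size (p ++ z :: q) = size (p ++ 0 :: q) by rewrite !size_cat.
  rewrite !ss; case: eqP => sz; last by rewrite scaler0 addr0.
  have ip : (size p < n)%N by rewrite -sz size_cat /= addnS ltnS leq_addr.
  by rewrite (upd _ _ sz ip (_ + _)) (upd _ _ sz ip u) (upd _ _ sz ip v) mf.
case: eqP => // sz.
have i1 : (size p < n)%N by rewrite -sz size_cat /= addnS ltnS leq_addr.
have i2 : ((size p).+1 < n)%N by rewrite -sz size_cat /= !addnS !ltnS leq_addr.
apply: (af _ (Ordinal i1) (Ordinal i2)); first by rewrite -val_eqE /= neq_ltn ltnSn.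
by rewrite /= !nth_cat ltnn subnn ltnNge leqnSn /= subSnn.
Qed.

Lemma dce_list_of_cochain f : f \in @cocycle K g M n ->
  forall xs, dce (list_of_cochain f) xs = 0.
Proof.
move=> /cocycleP[Cf df] [//|y xs].
have [sz|sz] := eqVneq (size xs) n; last first.
  apply: (dce_size (n := size xs)) => // t st.
  by rewrite /list_of_cochain st (negPf sz).
have [x ->] : exists x : 'I_n.+1 -> g, y :: xs = tolist x.
  exists (fun i => nth 0 (y :: xs) i).
  apply: (@eq_from_nth _ 0) => [|i]; rewrite /= ?size_tolist sz // => ilt.
  by rewrite (nth_tolist _ 0 (Ordinal ilt)).
rewrite -ce_diff_tolist; last exact: am_list_of_cochain.
by under eq_fun do rewrite list_of_cochainK; rewrite df.
Qed.

End CochainList.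
End CEList.

Lemma ce_diff_morph (K : fieldType) (g : lieAlgType K) (M M' : lieModType g)
    (e : M -> M') n (f : ('I_n -> g) -> M) x :
    linear e -> (forall y m, e (act y m) = act y (e m)) ->
  e (ce_diff f x) = ce_diff (e \o f) x.
Proof.
move=> elin eact.
have e0 : e 0 = 0 by have := elin (-1) 0 0; rewrite scaleN1r addNr scaleN1r addNr.
have eD : {morph e : u v / u + v} by move=> u v; rewrite -[u]scale1r elin !scale1r.
have eZ a u : e (a *: u) = a *: e u by rewrite -[a *: u]addr0 elin e0 addr0.
rewrite /ce_diff eD !(big_morph e eD e0); congr (_ + _); apply: eq_bigr => j _.
  by rewrite eZ eact.
by rewrite (big_morph e eD e0); apply: eq_bigr => i _; rewrite eZ.
Qed.

(** * The coinduced module and the lifting of cocycles *)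

Section Coinduced.
Variables (K : fieldType) (g h : lieAlgType K) (phi : lieHom g h).
Variable N : lieModType g.

Definition coind_pred : {pred seq h -> N} :=
  [pred u | `[< forall k, wordfun phi k u >]].

Fact coind_submod : submod_closed coind_pred.
Proof.
split; first by apply/asboolP => k; apply: wordfun0.
move=> a u u' /asboolP wu /asboolP wu'; apply/asboolP => k; exact: wordfunP.
Qed.

HB.instance Definition _ :=
  GRing.isSubmodClosed.Build K (seq h -> N) coind_pred coind_submod.

(* Hom_U(g)(U(h), N), with h acting through right multiplication on U(h).     *)
Definition coind : Type := {u : seq h -> N | u \in coind_pred}.
HB.instance Definition _ := SubChoice.on coind.
HB.instance Definition _ := [SubChoice_isSubLmodule of coind by <:].

Lemma coindP (u : coind) k : wordfun phi k (\val u).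
Proof. by have /asboolP := valP u. Qed.

Definition Coind u (wu : forall k, wordfun phi k u) : coind := Sub u (asboolT wu).

Definition coind_act (y : h) (u : coind) : coind :=
  Coind (fun k => wordfun_cons y (coindP u k.+1)).

Fact coind_actPl (a : K) (x y : h) (m : coind) :
  coind_act (a *: x + y) m = a *: coind_act x m + coind_act y m.
Proof.
apply/val_inj/funext => w; apply: (wf_lin (coindP m (size w).+1) (p := [::])).
by [].
Qed.

Fact coind_actPr (a : K) (x : h) (m p : coind) :
  coind_act x (a *: m + p) = a *: coind_act x m + coind_act x p.
Proof. exact/val_inj/funext. Qed.

Fact coind_act_bracket (x y : h) (m : coind) : coind_act (bracket x y) m =
  coind_act x (coind_act y m) - coind_act y (coind_act x m).
Proof.
apply/val_inj/funext => w; apply/esym.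
exact: (wf_rel (coindP m (size w).+2) (p := [::])).
Qed.

HB.instance Definition _ := @Lmodule_isLieModule.Build K h coind
  coind_act coind_actPl coind_actPr coind_act_bracket.

Definition coind_ev (u : coind) : N := \val u [::].

Lemma coind_ev_act x (u : coind) : coind_ev (act (phi x) u) = act x (coind_ev u).
Proof. exact: (wf_act (coindP u 1) (p := [::])). Qed.

(** Since h acts on the coinduced module by lengthening words, evaluation at w turns the
    Chevalley-Eilenberg differential into [dlist]. *)
Lemma val_dce (c : seq h -> coind) ys w :
  \val (dce c ys) w = dlist (fun w t => \val (c t) w) w ys.
Proof.
have val_ad y (b : seq h -> coind) t :
    \val (ad_sum y b t) w = ad_sum y (fun t => \val (b t) w) t.
  by elim: t b => //= z t IH b; rewrite -IH.
by elim: ys c => //= y ys IH c; rewrite -IH -val_ad.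
Qed.

End Coinduced.

(** For fixed arguments t, the map w |-> r w t from [cocycle_extend] is an element of the coinduced
    module; closedness in t is [val_dce], and the value at the empty word restores f. *)
Lemma coind_surjective (K : fieldType) (g h : lieAlgType K) (phi : lieHom g h)
    (N : lieModType g) n (f : ('I_n -> g) -> N) :
    injective phi -> f \in @cocycle K g N n ->
  exists2 F : ('I_n -> h) -> coind phi N, F \in @cocycle K h (coind phi N) n &
    forall x, coind_ev (F (phi \o x)) = f x.
Proof.
move=> phi_inj Zf; have /cocycleP[Cf _] := Zf.
have [r [wr dr rf]] := cocycle_extend phi_inj (am_list_of_cochain Cf)
  (dce_list_of_cochain Zf).
pose c t : coind phi N := Coind (fun k => wordfun_val t (wr k)).
have amc : alt_multilinear c.
  split=> [p q a u v|p q u]; apply/val_inj/funext => w.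
    exact: (am_lin (altmodP (r w))).
  exact: (am_alt (altmodP (r w))).
exists (fun x => c (tolist x)) => [|x].
  apply/cocycleP; split; first exact: cochain_of_list.
  apply/funext => x; rewrite ce_diff_tolist //; apply/val_inj/funext => w.
  by rewrite val_dce dr.
rewrite -(list_of_cochainK f x) -rf /coind_ev /=; congr (\val (r _) _).
by rewrite /tolist map_comp.
Qed.

(** * Comparison of the two dimensions *)

Lemma cohomology_eq0 (K : fieldType) (g : lieAlgType K) (M : lieModType g) n
    (z : Zspace M n) :
  (\pi_(cohomology M n) z == 0) = (z \in @coboundary K g M n).
Proof. by rewrite -[z in RHS]subr0 Quotient.idealrBE; rewrite [X in _ == X]piE. Qed.

Definition trivial_mod (K : fieldType) (g : lieAlgType K) : Type := K^o.

Section TrivialModule.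
Variables (K : fieldType) (g : lieAlgType K).
HB.instance Definition _ := GRing.Lmodule.copy (trivial_mod g) K^o.

Let triv_act (_ : g) (_ : trivial_mod g) : trivial_mod g := 0.

Fact triv_actP (a : K) (m : trivial_mod g) : m = 0 -> m = a *: m + m.
Proof. by move=> ->; rewrite scaler0 addr0. Qed.

Fact triv_act_bracket (x y : g) (m : trivial_mod g) : triv_act (bracket x y) m =
  triv_act x (triv_act y m) - triv_act y (triv_act x m).
Proof. by rewrite subrr. Qed.

HB.instance Definition _ := @Lmodule_isLieModule.Build K g (trivial_mod g)
  triv_act (fun a _ _ _ => triv_actP a erefl) (fun a _ _ _ => triv_actP a erefl)
  triv_act_bracket.

(** The constant 1 is an invariant. This puts 0 among the degrees, as [nat_sup_max] requires. *)
Lemma trivial_H0 : exists c : cohomology (trivial_mod g) 0, c <> 0.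
Proof.
pose f (_ : 'I_0 -> g) : trivial_mod g := (1 : K).
have Zf : f \in @cocycle K g (trivial_mod g) 0.
  apply/cocycleP; split; first by apply/cochainP; split=> [[]|? []].
  by apply/funext => x; rewrite /ce_diff !big_ord1 big_ord0 scaler0 addr0.
exists (\pi_(cohomology (trivial_mod g) 0) (Sub f Zf)) => /eqP.
rewrite cohomology_eq0 => /coboundaryP; rewrite SubK /=.
move=> /(congr1 (@^~ (fun i => 0))).
by apply/eqP; exact: (oner_neq0 K).
Qed.

End TrivialModule.

(** A least upper bound m is attained: for m = 0 by assumption, otherwise because m - 1 would be a
    bound too. For an empty set the two would differ, with supremum 0 and no maximum. *)
Lemma nat_sup_max (P : nat -> Prop) : P 0 -> nat_sup P = nat_max P.
Proof.
move=> P0; rewrite /nat_sup /nat_max.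
case: pselect => [e|ne]; case: pselect => [e'|ne'] //.
- case: cid => m [ubm lm]; case: cid => m' [Pm' ubm'] /=; congr Some; apply/eqP.
  by rewrite eqn_leq ubm // lm.
- case: ne'; have [m [ubm lm]] := e; exists m; split => //.
  case: m ubm lm => // m ubm lm; apply: contrapT => nP.
  have : nat_ub P m.
    move=> n Pn; have := ubm n Pn.
    by rewrite leq_eqVlt => /orP[/eqP nm|//]; rewrite nm in Pn.
  by move=> /lm; rewrite ltnn.
- by case: ne; have [m [Pm ubm]] := e'; exists m; split => // b /(_ m Pm).
Qed.

Theorem proposition4p2 (K : fieldType) (g h : lieAlgType K) (phi : lieHom g h)
  (phi_inj : injective phi) : cd_hom phi = cd g.
Proof.
rewrite /cd_hom /cd.
have -> : (fun n => exists (M : lieModType h) (c : cohomology M n),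
      induced_map phi c <> 0)
    = (fun n => exists (M : lieModType g) (c : cohomology M n), c <> 0).
  apply/funext => n; apply/propext; split=> [[M [c nz]]|[N [c nz]]].
    by exists (restr phi M), (induced_map phi c).
  have Zf := valP (repr c).
  have [F ZF FE] := coind_surjective phi_inj Zf.
  exists (coind phi N), (\pi_(cohomology (coind phi N) n) (Sub F ZF)).
  rewrite induced_map_pi => /eqP; rewrite cohomology_eq0 => /coboundaryP.
  rewrite SubK /= => B; apply: nz; apply/eqP; rewrite -[c]reprK cohomology_eq0.
  apply/coboundaryP.
  case: n c Zf F ZF FE B => [|n] c Zf F ZF FE /=.
    by move=> F0; apply/funext => x; rewrite -FE -[F _]/(pullback phi F x) F0.
  (* If b is a primitive of the pullback of F, then ev b is one of f = ev (phi^* F), since ev is a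
     map of g-modules. *)
  move=> [b Cb Fb]; exists (@coind_ev _ _ _ phi N \o b).
    have /cochainP[mb ab] := Cb; apply/cochainP; split=> [i x a u v|x i j ij xij] /=.
      by rewrite mb.
    by rewrite (ab x i j).
  apply/funext => x; rewrite -FE -[F _]/(pullback phi F x) Fb.
  by apply: ce_diff_morph => // y m; exact: coind_ev_act.
apply: nat_sup_max; exists (trivial_mod g); exact: trivial_H0.
Qed.
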